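(* Let $X$ be a separable infinite-dimensional Banach lattice. The following are equivalent: (1) $c_0$ isomorphically embeds into $X$; (2) $c_0$ bi-Lipschitzly embeds into $X$; (3) $c_0$ coarsely embeds into $X$; (4) $X$ is metric elastic; (5) the sequence of interlacing graphs $([\mathbb{N}]^k,d^{(k)}_{\mathrm{I}})_{k\in\mathbb{N}}$ embeds equi-bi-Lipschitzly into $X$; (6) $([\mathbb{N}]^k,d^{(k)}_{\mathrm{I}})_{k\in\mathbb{N}}$ embeds equi-coarsely into $X$.
   Context: For $k\in\mathbb{N}$, $[\mathbb{N}]^k$ is the set of $k$-element subsets of $\mathbb{N}$; $A=\{a_1<\dots<a_k\}\ne B=\{b_1<\dots<b_k\}$ are adjacent iff either $a_i\le b_i\le a_{i+1}$ ($1\le i<k$) and $a_k\le b_k$, or $b_i\le a_i\le b_{i+1}$ ($1\le i<k$) and $b_k\le a_k$; $d^{(k)}_{\mathrm{I}}$ is the graph metric. A metric space $Y$ is metric $K$-elastic ($K\ge1$) if every metric space that bi-Lipschitzly embeds into $Y$ bi-Lipschitzly embeds into $Y$ with distortion at most $K$; $Y$ is metric elastic if it is metric $K$-elastic for some $K$. A family $\{X_i\}$ embeds equi-coarsely (resp. equi-bi-Lipschitzly) into $Y$ if there are non-decreasing $\rho,\omega:[0,\infty)\to[0,\infty)$ with $\rho(t)\to\infty$ (resp. $\rho,\omega$ increasing and linear) and maps $f_i:X_i\to Y$ with $\rho(d(x,y))\le d(f_i(x),f_i(y))\le\omega(d(x,y))$ for all $i$ and $x,y\in X_i$. A coarse embedding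 is such a map for a single space. *)

(* Defs.v *)
From HB Require Import structures.
From mathcomp Require Import all_boot all_order all_algebra.
From mathcomp Require Import all_classical all_reals all_analysis.
Set Implicit Arguments. Unset Strict Implicit. Unset Printing Implicit Defensive.
Import Order.TTheory GRing.Theory Num.Theory.
Import numFieldNormedType.Exports.
Local Open Scope classical_set_scope.
Local Open Scope ring_scope.

Section Defs.
Variable R : realType.

Definition is_metric (T : Type) (d : T -> T -> R) : Prop :=
  [/\ forall x y, 0 <= d x y,
      forall x y, d x y = 0 <-> x = y,
      forall x y, d x y = d y x &
      forall x y z, d x z <= d x y + d y z].

Definition bilip_dist_le (T U : Type) (d : T -> T -> R) (d' : U -> U -> R)
  (K : R) (f : T -> U) : Prop :=
  exists2 s : R, 0 < s & forall x y, s * d x y <= d' (f x) (f y) <= K * s * d x y.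

Definition bilip_embeds (T U : Type) (d : T -> T -> R) (d' : U -> U -> R) : Prop :=
  exists (f : T -> U) (K : R), bilip_dist_le d d' K f.

Definition bilip_embeds_with (T U : Type) (d : T -> T -> R) (d' : U -> U -> R)
  (K : R) : Prop := exists f : T -> U, bilip_dist_le d d' K f.

Definition metric_K_elastic (Y : Type) (dY : Y -> Y -> R) (K : R) : Prop :=
  forall (T : Type) (d : T -> T -> R), is_metric d ->
    bilip_embeds d dY -> bilip_embeds_with d dY K.

Definition metric_elastic (Y : Type) (dY : Y -> Y -> R) : Prop :=
  exists2 K : R, 1 <= K & metric_K_elastic dY K.

Definition nondecr_nonneg (g : R -> R) : Prop :=
  (forall t, 0 <= t -> 0 <= g t) /\ (forall s t, 0 <= s -> s <= t -> g s <= g t).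

Definition coarse_bounds (T U : Type) (d : T -> T -> R) (d' : U -> U -> R)
  (rho omega : R -> R) (f : T -> U) : Prop :=
  forall x y, rho (d x y) <= d' (f x) (f y) <= omega (d x y).

Definition coarse_embeds (T U : Type) (d : T -> T -> R) (d' : U -> U -> R) : Prop :=
  exists (rho omega : R -> R) (f : T -> U),
    [/\ nondecr_nonneg rho, nondecr_nonneg omega,
        rho t @[t --> +oo] --> +oo & coarse_bounds d d' rho omega f].

Definition equi_coarse_embeds (Tk : nat -> Type) (dk : forall k, Tk k -> Tk k -> R)
  (U : Type) (d' : U -> U -> R) : Prop :=
  exists (rho omega : R -> R),
    [/\ nondecr_nonneg rho, nondecr_nonneg omega,
        rho t @[t --> +oo] --> +oo &
        forall k, exists f : Tk k -> U, coarse_bounds (dk k) d' rho omega f].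

Definition equi_bilip_embeds (Tk : nat -> Type) (dk : forall k, Tk k -> Tk k -> R)
  (U : Type) (d' : U -> U -> R) : Prop :=
  exists (a b : R), [/\ 0 < a, 0 < b &
    forall k, exists f : Tk k -> U,
      forall x y, a * dk k x y <= d' (f x) (f y) <= b * dk k x y].

Definition is_sup2 (X : completeNormedModType R) (le : X -> X -> Prop)
  (x y s : X) : Prop :=
  [/\ le x s, le y s & forall u, le x u -> le y u -> le s u].

Definition is_banach_lattice (X : completeNormedModType R)
  (le : X -> X -> Prop) : Prop :=
  [/\ (forall x, le x x),
      (forall x y, le x y -> le y x -> x = y),
      (forall x y z, le x y -> le y z -> le x z),
      (forall x y z, le x y -> le (x + z) (y + z)) &
      (forall (a : R) x y, 0 <= a -> le x y -> le (a *: x) (a *: y))] /\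
  (forall x y, exists s, is_sup2 le x y s) /\
  (forall x y ax ay, is_sup2 le x (- x) ax -> is_sup2 le y (- y) ay ->
          le ax ay -> `|x| <= `|y|).

Definition separable (X : completeNormedModType R) : Prop :=
  exists f : nat -> X, closure (range f) = setT.

Definition infinite_dimensional (X : completeNormedModType R) : Prop :=
  forall n : nat, exists v : 'I_n -> X,
    forall c : 'I_n -> R, \sum_(i < n) c i *: v i = 0 -> forall i, c i = 0.

Definition norm_dist (X : completeNormedModType R) (x y : X) : R := `|x - y|.

Definition c0 : Type := {u : nat -> R | u n @[n --> \oo] --> (0 : R)}.

Definition c0_dist (u v : c0) : R :=
  sup (range (fun n => `|sval u n - sval v n|)).

Definition c0_norm (u : c0) : R := sup (range (fun n => `|sval u n|)).

Definition c0_iso_embeds (X : completeNormedModType R) : Prop :=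
  exists (T : c0 -> X) (a b : R),
    [/\ forall (r : R) (u v w : c0), sval w = (fun n => r * sval u n + sval v n) ->
           T w = r *: T u + T v,
        0 < a, 0 < b &
        forall u, a * c0_norm u <= `|T u| <= b * c0_norm u].

End Defs.

(* k-subsets of N as strictly increasing sequences of length k. *)
Definition ksub (k : nat) : Type := {s : seq nat | (size s == k) && sorted ltn s}.

Definition ksub_elt (k : nat) (A : ksub k) (i : nat) : nat := nth 0%N (sval A) i.

(* one-sided interlacing: a_i <= b_i <= a_{i+1} (1 <= i < k) and a_k <= b_k,
   written with 0-based indices *)
Definition interl (k : nat) (A B : ksub k) : Prop :=
  (forall i, (i.+1 < k)%N ->
     (ksub_elt A i <= ksub_elt B i)%N /\ (ksub_elt B i <= ksub_elt A i.+1)%N) /\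
  ((0 < k)%N -> (ksub_elt A k.-1 <= ksub_elt B k.-1)%N).

Definition interl_adj (k : nat) (A B : ksub k) : Prop :=
  A <> B /\ (interl A B \/ interl B A).

Fixpoint walk (T : Type) (adj : T -> T -> Prop) (n : nat) (A B : T) : Prop :=
  match n with
  | 0 => A = B
  | m.+1 => exists C, adj A C /\ walk adj m C B
  end.

Definition interl_dist (R : realType) (k : nat) (A B : ksub k) : R :=
  inf [set (n%:R : R) | n in [set n : nat | walk (@interl_adj k) n A B]].

(* Main.v *)
Require Import Defs.
From HB Require Import structures.
From mathcomp Require Import all_boot all_order all_algebra.
From mathcomp Require Import all_classical all_reals all_analysis.
From mathcomp Require Import ring lra zify.
Set Implicit Arguments. Unset Strict Implicit. Unset Printing Implicit Defensive.
Import Order.TTheory GRing.Theory Num.Theory.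
Import numFieldNormedType.Exports.
Local Open Scope classical_set_scope.
Local Open Scope ring_scope.

(** The only hard implication is the last one: if the interlacing graphs embed
    equi-coarsely into the Banach lattice [X], then [X] contains [c_0].

    Suppose it does not.  Then increasing norm bounded sequences of [X] converge
    (otherwise suitable increments span [c_0], by James's argument), so [X] is a
    projection band of its bidual.  Given bounded maps [f : [N]^k -> X] that are
    [w]-Lipschitz on interlacing pairs, iterate "weak-star limit in the last
    variable, then band projection onto [X]" down to a single vector [x].
    Interlacing averages of [f] differ from [x] by singular parts.  The singular
    parts of two interlacing families cannot cancel, so the modulus [V] of their sum
    is bounded by averages of [|f(n) - f(l)|], whose norm is at most [w].  Hence
    [f(m)] is within about [2w] of [x] for suitable [m] arbitrarily far out, and two
    such [m < m'] at distance [k] in the graph contradict the lower bound when [k]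
    is large.  The bidual is never formed: weak-star limits are replaced by dyadic
    averages, the projection by truncation to order intervals, and weak compactness
    of order intervals by a minimisation argument.

    For the other implications, separable metric spaces embed into [c_0] with
    a universal distortion (Aharoni), which makes [X] elastic as soon as it contains
    [c_0]; and an interlacing graph, being bounded, countable and uniformly discrete,
    embeds onto a separated sequence of any infinite-dimensional space, so that
    elasticity bounds the distortion of these embeddings independently of [k]. *)

(** * Linear identities and Banach lattice calculus *)

Section LinearIdentities.
Variables (R : realType) (V : lmodType R).

Inductive vexp := VZ | VX of nat | VA of vexp & vexp | VN of vexp | VS of R & vexp.

Fixpoint veval (e : seq V) (x : vexp) : V := match x with
  | VZ => 0 | VX n => nth 0 e n | VA x y => veval e x + veval e y
  | VN x => - veval e x | VS r x => r *: veval e x end.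

Fixpoint vcoef (x : vexp) (n : nat) : R := match x with
  | VZ => 0 | VX m => if m == n then 1 else 0
  | VA x y => vcoef x n + vcoef y n
  | VN x => - vcoef x n | VS r x => r * vcoef x n end.

Lemma veval_coef (e : seq V) (x : vexp) :
  veval e x = \sum_(i < size e) vcoef x i *: nth 0 e i.
Proof.
elim: x => [|n|x IHx y IHy|x IHx|r x IHx] /=.
- by rewrite big1// => i _; rewrite scale0r.
- have [ne|en] := ltnP n (size e).
    rewrite (bigD1 (Ordinal ne))//= eqxx scale1r big1 ?addr0// => i /negPf ni.
    by case: eqP => [E|_]; [move: ni; rewrite -val_eqE/= E eqxx|rewrite scale0r].
  rewrite nth_default// big1// => i _; case: eqP => [E|_]; last by rewrite scale0r.
  by move: (ltn_ord i); rewrite -E ltnNge en.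
- by rewrite IHx IHy -big_split; apply: eq_bigr => i _; rewrite scalerDl.
- by rewrite IHx -sumrN; apply: eq_bigr => i _; rewrite scaleNr.
- by rewrite IHx scaler_sumr; apply: eq_bigr => i _; rewrite scalerA.
Qed.

(** A recursive conjunction instead of a bounded quantifier: for a concrete list of atoms it
    computes to one scalar equation per atom. *)
Fixpoint vcoefs_eq (n : nat) (x y : vexp) : Prop := match n with
  | 0 => True | n.+1 => vcoef x n = vcoef y n /\ vcoefs_eq n x y end.

Lemma veval_eq (e : seq V) (x y : vexp) :
  vcoefs_eq (size e) x y -> veval e x = veval e y.
Proof.
move=> H; rewrite !veval_coef; apply: eq_bigr => -[i/= ie] _; congr (_ *: _).
elim: (size e) ie H => // n IH; rewrite ltnS leq_eqVlt => /orP[/eqP->[]//|ni] [_].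
exact: IH.
Qed.

End LinearIdentities.

(* Syntactic equality of vector expressions, up to the structure instances
   carried by the operations: the same sum may be elaborated along different
   inheritance paths. *)
Ltac v_same a b :=
  first [constr_eq a b |
    lazymatch a with
    | @GRing.add _ ?a1 ?a2 => lazymatch b with
        @GRing.add _ ?b1 ?b2 => v_same a1 b1; v_same a2 b2 end
    | @GRing.opp _ ?a1 => lazymatch b with @GRing.opp _ ?b1 => v_same a1 b1 end
    | @GRing.zero _ => lazymatch b with @GRing.zero _ => idtac end
    | @GRing.scale _ _ ?r ?a1 => lazymatch b with
        @GRing.scale _ _ ?s ?b1 => constr_eq r s; v_same a1 b1 end
    | ?f ?a1 => lazymatch b with ?g ?b1 => v_same f g; v_same a1 b1 end
    end].

Ltac v_index a l :=
  match l with
  | ?b :: _ => let _ := match goal with _ => v_same a b end in constr:(0%N)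
  | _ :: ?t => let n := v_index a t in constr:(n.+1)
  end.

Ltac v_atoms V e l :=
  match e with
  | @GRing.add _ ?a ?b => let l1 := v_atoms V a l in v_atoms V b l1
  | @GRing.opp _ ?a => v_atoms V a l
  | @GRing.scale _ _ _ ?a => v_atoms V a l
  | @GRing.zero _ => l
  | _ => match l with
         | _ => let n := v_index e l in l
         | _ => constr:((e : V) :: l)
         end
  end.

Ltac v_reify R l e :=
  match e with
  | @GRing.add _ ?a ?b =>
      let x := v_reify R l a in let y := v_reify R l b in constr:(@VA R x y)
  | @GRing.opp _ ?a => let x := v_reify R l a in constr:(@VN R x)
  | @GRing.scale _ _ ?r ?a => let x := v_reify R l a in constr:(@VS R r x)
  | @GRing.zero _ => constr:(@VZ R)
  | _ => let n := v_index e l in constr:(@VX R n)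
  end.

(* [ring] does not apply to modules: [vlin] reifies both sides of an equation
   between vectors and leaves to [ring] and [field] the comparison of the
   coefficients of each atom. *)
Ltac vlin :=
  match goal with
  | X : completeNormedModType ?R |- @eq _ ?a ?b =>
    let l0 := v_atoms X a (@nil X) in
    let l := v_atoms X b l0 in
    let x := v_reify R l a in let y := v_reify R l b in
    refine (@veval_eq R X l x y _); cbn [size vcoefs_eq vcoef];
    repeat split; rewrite /=; try solve [ring | by field | by field; lra]
  end.


(** * Moduli, positive parts and the closed order of a Banach lattice *)

Section VectorLattice.
Variables (R : realType) (X : completeNormedModType R) (le : X -> X -> Prop).
Implicit Types (x y z u v w : X) (r t : R).

Local Notation "x <=| y" := (le x y) (at level 70).

(** [ab], [ps] and [pn] are |x|, x^+ and ||x^+||. Approximate inequalities are written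
    [pn (x - y) <= e]: x <= y up to a positive vector of norm at most e. *)
Definition sup2 x y : X := xget 0 [set s | is_sup2 le x y s].
Definition ab x : X := sup2 x (- x).
Definition ps x : X := sup2 x 0.
Definition pn x : R := `|ps x|.

Hypothesis HL : is_banach_lattice le.

Lemma vle_refl x : x <=| x.
Proof. by case: HL => -[H _ _ _ _] _. Qed.

Lemma vle_anti x y : x <=| y -> y <=| x -> x = y.
Proof. by case: HL => -[_ H _ _ _] _; exact: H. Qed.

Lemma vle_trans y x z : x <=| y -> y <=| z -> x <=| z.
Proof. by case: HL => -[_ _ H _ _] _; exact: H. Qed.

Lemma vle_addr z x y : x <=| y -> x + z <=| y + z.
Proof. by case: HL => -[_ _ _ H _] _; exact: H. Qed.

Lemma vle_scale r x y : 0 <= r -> x <=| y -> r *: x <=| r *: y.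
Proof. by case: HL => -[_ _ _ _ H] _; exact: H. Qed.

Lemma vle_add x y u v : x <=| y -> u <=| v -> x + u <=| y + v.
Proof.
move=> xy uv; apply: (vle_trans (vle_addr u xy)).
by rewrite ![y + _]addrC; exact: vle_addr.
Qed.

(** An inequality depends only on the difference of its sides. Fed with a sum of known inequalities,
    this leaves a linear identity for [vlin]. *)
Lemma vle_eq x y u v : x <=| y -> y - x = v - u -> u <=| v.
Proof.
move=> xy E; have := vle_addr (u - x) xy.
by rewrite addrCA subrr addr0 addrCA E addrC subrK.
Qed.

Lemma vle_ge0 x y : 0 <=| y - x -> x <=| y.
Proof. by move=> H; apply: (vle_eq H); rewrite subr0. Qed.

Lemma vle_opp x y : x <=| y -> - y <=| - x.
Proof. by move=> H; apply: (vle_eq H); rewrite opprK addrC. Qed.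

Lemma sup2P x y : is_sup2 le x y (sup2 x y).
Proof. by case: HL => _ [H _]; have [s sP] := H x y; rewrite /sup2; exact: xgetI sP. Qed.

Lemma sup2l x y : x <=| sup2 x y. Proof. by case: (sup2P x y). Qed.
Lemma sup2r x y : y <=| sup2 x y. Proof. by case: (sup2P x y). Qed.
Lemma sup2_lub x y z : x <=| z -> y <=| z -> sup2 x y <=| z.
Proof. by case: (sup2P x y) => _ _; apply. Qed.

Lemma ab_ge x : x <=| ab x. Proof. exact: sup2l. Qed.
Lemma ab_geN x : - x <=| ab x. Proof. exact: sup2r. Qed.
Lemma ab_le x y : x <=| y -> - x <=| y -> ab x <=| y.
Proof. exact: sup2_lub. Qed.

Lemma ab_ge0 x : 0 <=| ab x.
Proof.
have h : (0 : R) <= 2^-1 by lra.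
apply: (vle_eq (vle_scale h (vle_add (ab_ge x) (ab_geN x)))); vlin.
Qed.

Lemma ab_id x : 0 <=| x -> ab x = x.
Proof.
move=> x0; apply: vle_anti; last exact: ab_ge.
apply: ab_le; first exact: vle_refl.
by apply: (vle_eq (vle_add x0 x0)); vlin.
Qed.

Lemma ab_ab x : ab (ab x) = ab x. Proof. exact/ab_id/ab_ge0. Qed.

Lemma ab0 : ab 0 = 0. Proof. exact/ab_id/vle_refl. Qed.

Lemma abN x : ab (- x) = ab x.
Proof.
have H y : ab (- y) <=| ab y.
  by apply: ab_le; [exact: ab_geN|rewrite opprK; exact: ab_ge].
by apply: vle_anti => //; have := H (- x); rewrite opprK.
Qed.

Lemma abB x y : ab (x - y) = ab (y - x).
Proof. by rewrite -abN opprB. Qed.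

Lemma ab_norm_le x y : ab x <=| ab y -> `|x| <= `|y|.
Proof. by case: HL => _ [_ H]; apply: H; exact: sup2P. Qed.

Lemma norm_ab x : `|ab x| = `|x|.
Proof.
by apply/eqP; rewrite eq_le !ab_norm_le// ab_ab; exact: vle_refl.
Qed.

Lemma norm_le_ab x y : ab x <=| y -> `|x| <= `|y|.
Proof.
move=> xy; apply: ab_norm_le; apply: (vle_trans xy); exact: ab_ge.
Qed.

Lemma norm_le x y : 0 <=| x -> x <=| y -> `|x| <= `|y|.
Proof. by move=> x0 xy; apply: norm_le_ab; rewrite ab_id. Qed.

Lemma ab_add x y : ab (x + y) <=| ab x + ab y.
Proof.
apply: ab_le; first exact: vle_add (ab_ge _) (ab_ge _).
by rewrite opprD; exact: vle_add (ab_geN _) (ab_geN _).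
Qed.

Lemma ab_scale r x : ab (r *: x) <=| `|r| *: ab x.
Proof.
have [r0|r0] := lerP 0 r.
  rewrite ger0_norm//; apply: ab_le; first exact: vle_scale r0 (ab_ge _).
  by rewrite -scalerN; exact: vle_scale r0 (ab_geN _).
have r0' : 0 <= - r by lra.
rewrite ltr0_norm//; apply: ab_le.
  by apply: (vle_eq (vle_scale r0' (ab_geN x))); vlin.
by apply: (vle_eq (vle_scale r0' (ab_ge x))); vlin.
Qed.

Lemma ab_tri x y : ab x <=| ab y + ab (x - y).
Proof. by have := ab_add y (x - y); rewrite addrCA subrr addr0. Qed.

Lemma ps_ge x : x <=| ps x. Proof. exact: sup2l. Qed.
Lemma ps_ge0 x : 0 <=| ps x. Proof. exact: sup2r. Qed.
Lemma ps_le x y : 0 <=| y -> x <=| y -> ps x <=| y.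
Proof. by move=> y0 xy; exact: sup2_lub. Qed.
Lemma ps_mono x y : x <=| y -> ps x <=| ps y.
Proof. by move=> xy; apply: ps_le (ps_ge0 _) (vle_trans xy (ps_ge _)). Qed.
Lemma ps_add x y : ps (x + y) <=| ps x + ps y.
Proof.
apply: ps_le; last exact: vle_add (ps_ge _) (ps_ge _).
by rewrite -[0]addr0; exact: vle_add (ps_ge0 _) (ps_ge0 _).
Qed.
Lemma ps_le_ab x : ps x <=| ab x.
Proof. exact: ps_le (ab_ge0 _) (ab_ge _). Qed.
Lemma ps_id x : 0 <=| x -> ps x = x.
Proof.
move=> x0; apply: vle_anti; last exact: ps_ge.
by apply: ps_le => //; exact: vle_refl.
Qed.

Lemma ps_scale r x : 0 <= r -> ps (r *: x) <=| r *: ps x.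
Proof.
move=> r0; apply: ps_le; last exact: vle_scale r0 (ps_ge _).
by apply: (vle_eq (vle_scale r0 (ps_ge0 x))); vlin.
Qed.

Lemma psN x : ps (- x) = ps x - x.
Proof.
apply: vle_anti.
  apply: ps_le; first by apply: (vle_eq (ps_ge x)); vlin.
  by apply: (vle_eq (ps_ge0 x)); vlin.
have H : ps x <=| ps (- x) + x.
  apply: ps_le; first by apply: (vle_eq (ps_ge (- x))); vlin.
  by apply: (vle_eq (ps_ge0 (- x))); vlin.
by apply: (vle_eq H); vlin.
Qed.

Lemma ab_ps x : ab x = ps x + ps (- x).
Proof.
rewrite psN; apply: vle_anti.
  apply: ab_le.
    by apply: (vle_eq (vle_add (ps_ge x) (ps_ge x))); vlin.
  by apply: (vle_eq (vle_add (ps_ge0 x) (ps_ge0 x))); vlin.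
have h : (0 : R) <= 2^-1 by lra.
(* Half of |x| + x is an upper bound of both x and 0. *)
have H : ps x <=| 2^-1 *: (ab x + x).
  apply: ps_le.
    by apply: (vle_eq (vle_scale h (ab_geN x))); vlin.
  by apply: (vle_eq (vle_scale h (ab_ge x))); vlin.
by apply: (vle_eq (vle_add H H)); vlin.
Qed.

Lemma pn_mono x y : x <=| y -> pn x <= pn y.
Proof. by move=> xy; apply: norm_le (ps_ge0 _) (ps_mono xy). Qed.

Lemma pn_add x y : pn (x + y) <= pn x + pn y.
Proof.
apply: le_trans (ler_normD _ _); apply: norm_le (ps_ge0 _) (ps_add _ _).
Qed.

Lemma pn_scale r x : 0 <= r -> pn (r *: x) <= r * pn x.
Proof.
move=> r0; have := norm_le (ps_ge0 _) (ps_scale x r0).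
by rewrite normrZ ger0_norm.
Qed.

Lemma pn_le_norm x : pn x <= `|x|.
Proof. by rewrite -norm_ab; exact: norm_le (ps_ge0 _) (ps_le_ab _). Qed.

Lemma pn_id x : 0 <=| x -> pn x = `|x|.
Proof. by move=> x0; rewrite /pn ps_id. Qed.

Lemma pn_ge0 x : 0 <= pn x. Proof. exact: normr_ge0. Qed.

Lemma pn_le0 x : x <=| 0 -> pn x = 0.
Proof.
move=> x0; rewrite /pn; have -> : ps x = 0; last exact: normr0.
by apply: vle_anti; [exact: ps_le (vle_refl _) x0|exact: ps_ge0].
Qed.

Lemma pn_eq0 x : pn x = 0 -> x <=| 0.
Proof. by move=> /eqP; rewrite normr_eq0 => /eqP <-; exact: ps_ge. Qed.

Lemma pn_small x : (forall e : R, 0 < e -> pn x <= e) -> x <=| 0.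
Proof.
move=> H; apply: pn_eq0; apply/eqP; rewrite eq_le pn_ge0 andbT.
by apply/ler_addgt0Pl => e e0; rewrite addr0; exact: H.
Qed.

Lemma vle_pn x y : x <=| y -> pn (x - y) = 0.
Proof. by move=> xy; apply: pn_le0; apply: (vle_eq xy); vlin. Qed.

(** The cone is closed because [pn] is dominated by the norm: in a - l = (a - s n) + (s n - l) the
    first term has zero positive part. *)
Lemma vle_lim (s : nat -> X) (l a : X) N :
  s @ \oo --> l -> (forall n, (N <= n)%N -> a <=| s n) -> a <=| l.
Proof.
move=> sl sa; suff : a - l <=| 0 by move=> H; apply: (vle_eq H); vlin.
apply: pn_small => e e0.
have /cvgrPdist_lt/(_ _ e0)[M _ HM] := sl.
apply: le_trans (ltW (HM (maxn M N) (leq_maxl _ _))); rewrite distrC.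
rewrite -(subrKA (s (maxn M N))); apply: le_trans (pn_add _ _) _.
by rewrite vle_pn ?add0r ?pn_le_norm//; apply: sa; rewrite leq_maxr.
Qed.

Lemma vlim_le (s : nat -> X) (l a : X) N :
  s @ \oo --> l -> (forall n, (N <= n)%N -> s n <=| a) -> l <=| a.
Proof.
move=> sl sa; suff H : - a <=| - l by apply: (vle_eq H); vlin.
apply: (@vle_lim (fun n => - s n) _ _ N); first exact: cvgN.
by move=> n Nn; exact/vle_opp/sa.
Qed.

End VectorLattice.

(** * Sequences, the space [c_0], and lattices without [c_0] *)

Section Sequences.
Variables (R : realType).

Lemma cvg_seqP (X : normedModType R) (s : nat -> X) (l : X) :
  s @ \oo --> l <->
  forall e : R, 0 < e -> exists N, forall n, (N <= n)%N -> `|s n - l| <= e.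
Proof.
split=> [sl e e0|H].
  have /cvgrPdist_le/(_ _ e0)[N _ HN] := sl.
  by exists N => n Nn; rewrite distrC; exact: HN.
apply/cvgrPdist_le => e e0; have [N HN] := H e e0.
by exists N => // n Nn; rewrite /= distrC; exact: HN.
Qed.

Lemma cauchy_seq_cvg (X : completeNormedModType R) (s : nat -> X) :
  (forall e : R, 0 < e -> exists N, forall n m, (N <= n)%N -> (n <= m)%N ->
     `|s m - s n| <= e) -> exists l : X, s @ \oo --> l.
Proof.
move=> H; suff : cvgn s by move/cvg_ex.
apply/cauchy_cvgP/cauchy_exP => e e0; have e20 : 0 < e / 2 by lra.
have [N HN] := H _ e20; exists (s N); exists N => // m /= Nm.
rewrite -ball_normE /ball_/= distrC; apply: le_lt_trans (HN N m (leqnn _) Nm) _.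
lra.
Qed.

Lemma cauchy_of_cvg (X : normedModType R) (s : nat -> X) (l : X) : s @ \oo --> l ->
  forall e : R, 0 < e -> exists N, forall n m, (N <= n)%N -> (N <= m)%N ->
     `|s m - s n| <= e.
Proof.
move=> /cvg_seqP H e e0; have e20 : 0 < e / 2 by lra.
have [N HN] := H _ e20; exists N => n m Nn Nm.
rewrite -(subrKA l); apply: le_trans (ler_normD _ _) _.
by rewrite [`|l - _|]distrC [leRHS]splitr lerD// HN.
Qed.

Lemma lim_norm_le (X : normedModType R) (s : nat -> X) (l : X) (M : R) : s @ \oo --> l ->
  (forall n, `|s n| <= M) -> `|l| <= M.
Proof.
move=> /cvg_seqP sl sM; apply/ler_addgt0Pr => e e0; have [N /(_ N (leqnn N)) HN] := sl e e0.
by rewrite -[l](subrK (s N)); apply: le_trans (ler_normD _ _) _; rewrite distrC addrC lerD.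
Qed.

Lemma inf_nonincr_cvg (g : nat -> R) (b : R) :
  (forall n, b <= g n) -> (forall n m, (n <= m)%N -> g m <= g n) ->
  exists K, [/\ b <= K, forall n, K <= g n &
    forall e : R, 0 < e -> exists N, forall n, (N <= n)%N -> g n <= K + e].
Proof.
move=> gb gm; set S := range g.
have S0 : S !=set0 by exists (g 0%N), 0%N.
have Sb : has_lbound S by exists b => _ [n _ <-].
exists (inf S); split=> [|n|e e0]; first by apply: lb_le_inf => // _ [n _ <-].
  by apply: (ge_inf Sb); exists n.
have [_ [N _ <-] HN] := inf_adherent e0 (conj S0 Sb).
by exists N => n /gm; lra.
Qed.

End Sequences.

(** * The space c_0 and its metric *)

Section C0.
Variables (R : realType).

Lemma c0_bounded (u : c0 R) : exists M, forall n, `|sval u n| <= M.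
Proof.
have /cvg_seqP/(_ _ ltr01)[N HN] := svalP u.
exists (1 + \sum_(i < N) `|sval u i|) => n; have [nN|Nn] := ltnP n N.
  rewrite (bigD1 (Ordinal nN))//=.
  by rewrite addrCA lerDl addr_ge0// sumr_ge0.
have := HN n Nn; rewrite subr0 => /le_trans; apply.
by rewrite lerDl sumr_ge0.
Qed.

Lemma c0_norm_ub (u : c0 R) n : `|sval u n| <= c0_norm u.
Proof.
apply: ub_le_sup; last by exists n.
by have [M HM] := c0_bounded u; exists M => _ [k _ <-].
Qed.

Lemma c0_norm_le (u : c0 R) M : (forall n, `|sval u n| <= M) -> c0_norm u <= M.
Proof.
by move=> H; apply: ge_sup => [|_ [n _ <-]//]; exists `|sval u 0%N|, 0%N.
Qed.

Lemma c0_norm_ge0 (u : c0 R) : 0 <= c0_norm u.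
Proof. exact: le_trans (normr_ge0 _) (c0_norm_ub u 0). Qed.

Lemma c0_lin_subproof (r : R) (u v : c0 R) :
  (fun n => r * sval u n + sval v n) @ \oo --> (0 : R).
Proof.
have H : (fun n => r * sval u n + sval v n) @ \oo --> (r * 0 + 0 : R).
  apply: cvgD; last exact: svalP v.
  by apply: cvgM; [exact: cvg_cst|exact: svalP u].
by move: H; rewrite mulr0 addr0.
Qed.

Definition c0_lin (r : R) (u v : c0 R) : c0 R :=
  exist _ (fun n => r * sval u n + sval v n) (c0_lin_subproof r u v).

Lemma c0_dist_lin (u v : c0 R) : c0_dist u v = c0_norm (c0_lin (-1) v u).
Proof.
rewrite /c0_dist /c0_norm; suff -> : (fun n => `|sval u n - sval v n|) =
  (fun n => `|sval (c0_lin (-1) v u) n|) by [].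
by apply/funext => n /=; rewrite mulN1r addrC.
Qed.

Lemma c0_dist_ub (u v : c0 R) n : `|sval u n - sval v n| <= c0_dist u v.
Proof. by rewrite c0_dist_lin; have := c0_norm_ub (c0_lin (-1) v u) n; rewrite /= mulN1r addrC. Qed.

Lemma c0_dist_le (u v : c0 R) M :
  (forall n, `|sval u n - sval v n| <= M) -> c0_dist u v <= M.
Proof.
by move=> H; rewrite c0_dist_lin; apply: c0_norm_le => n; rewrite /= mulN1r addrC.
Qed.

Lemma c0_dist_ge0 (u v : c0 R) : 0 <= c0_dist u v.
Proof. by rewrite c0_dist_lin c0_norm_ge0. Qed.

Lemma c0_iso_bilip (X : completeNormedModType R) : c0_iso_embeds X ->
  exists (T : c0 R -> X) (a b : R), [/\ 0 < a, 0 < b &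
    forall u v, a * c0_dist u v <= `|T u - T v| <= b * c0_dist u v].
Proof.
move=> [T [a [b [lin a0 b0 H]]]]; exists T, a, b; split=> // u v.
rewrite c0_dist_lin; have := H (c0_lin (-1) v u).
by rewrite (lin (-1) v u)// scaleN1r addrC.
Qed.

End C0.

(** * Copies of c_0 and the Kantorovich-Banach property *)

Section C0Embedding.
Variables (R : realType) (X : completeNormedModType R) (le : X -> X -> Prop).
Hypothesis HL : is_banach_lattice le.

Local Notation "x <=| y" := (le x y) (at level 70).

Lemma vle_sum (I : Type) (r : seq I) (P : pred I) (F G : I -> X) :
  (forall i, P i -> F i <=| G i) -> \sum_(i <- r | P i) F i <=| \sum_(i <- r | P i) G i.
Proof.
move=> H; elim/big_ind2 : _ => //; first exact: (vle_refl HL).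
by move=> *; exact: vle_add.
Qed.

Lemma ab_sum (I : Type) (r : seq I) (P : pred I) (F : I -> X) :
  ab le (\sum_(i <- r | P i) F i) <=| \sum_(i <- r | P i) ab le (F i).
Proof.
elim/big_ind2 : _ => //; first by rewrite (ab0 HL); exact: (vle_refl HL).
- by move=> x y u v xy uv; apply: vle_trans (vle_add HL xy uv) => //; exact: ab_add.
- by move=> i _; exact: (vle_refl HL).
Qed.

(** The [v n] being positive, the modulus of the combination is at most [s] times their plain
    sum. *)
Lemma sum_seg_norm (v : nat -> X) (a : nat -> R) (s be : R) (p q : nat) :
  (forall n, 0 <=| v n) -> (forall p q, `|\sum_(p <= n < q) v n| <= be) ->
  0 <= s -> (forall n, (p <= n < q)%N -> `|a n| <= s) ->
  `|\sum_(p <= n < q) a n *: v n| <= s * be.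
Proof.
move=> v0 vb s0 H; apply: (@le_trans _ _ `|s *: \sum_(p <= n < q) v n|); last first.
  by rewrite normrZ ger0_norm// ler_wpM2l.
apply: (norm_le_ab HL); apply: (vle_trans HL (ab_sum _ _ _)).
rewrite scaler_sumr big_nat_cond [X in _ <=| X]big_nat_cond; apply: vle_sum => n.
rewrite andbT => /H Hn; apply: (vle_trans HL (ab_scale HL _ _)).
rewrite (ab_id HL)//; apply: (vle_ge0 HL); rewrite -scalerBl.
have h : 0 <= s - `|a n| by lra.
by have := vle_scale HL h (v0 n); rewrite scaler0.
Qed.

(* A positive sequence with bounded partial sums spans c_0.  The lower estimate
   is James's: flipping the sign of one coefficient keeps the upper bound. *)
Lemma c0_of_blocks (v : nat -> X) (al be : R) : (forall n, 0 <=| v n) ->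
  (forall n, al <= `|v n|) -> (forall p q, `|\sum_(p <= n < q) v n| <= be) ->
  0 < be -> be < 2 * al -> c0_iso_embeds X.
Proof.
move=> v0 hv vbe be0 beal.
pose S (u : nat -> R) N := \sum_(0 <= n < N) u n *: v n.
have Scvg (u : c0 R) : exists l : X, S (sval u) @ \oo --> (l : X).
  apply: cauchy_seq_cvg => e e0.
  have d0 : 0 < e / be by rewrite divr_gt0.
  have /cvg_seqP/(_ _ d0)[N HN] := svalP u.
  exists N => n m Nn nm; rewrite /S (@big_cat_nat _ _ _ n 0 m)//= addrAC subrr add0r.
  have -> : e = (e / be) * be by field; lra.
  apply: sum_seg_norm => //; first exact: ltW.
  by move=> k /andP[nk _]; have := HN k (leq_trans Nn nk); rewrite subr0.
pose T u := sval (cid (Scvg u)).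
have TP u : S (sval u) @ \oo --> T u by rewrite /T; case: cid.
(* The lower constant comes from [2 * al * |u j| <= |T u| + be * c0_norm u], on taking the supremum
   over [j]. *)
exists T, (2 * al - be), be; split=> //; last 2 first.
- by rewrite subr_gt0.
- move=> u; apply/andP; split; last first.
    rewrite mulrC; apply: (lim_norm_le (TP u)) => N.
    by apply: sum_seg_norm => // [|n _]; [exact: c0_norm_ge0|exact: c0_norm_ub].
  have H j : 2 * al * `|sval u j| <= `|T u| + c0_norm u * be.
    (* The shift by [j.+1] puts the index [j] into every partial sum. *)
    have cv : (fun N => S (sval u) (N + j.+1)%N - (2 * sval u j) *: v j) @ \oo -->
        T u - (2 * sval u j) *: v j.
      apply: cvgB; last exact: cvg_cst.
      by move: (TP u); rewrite -(cvg_shiftn j.+1).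
    have HT : `|T u - (2 * sval u j) *: v j| <= c0_norm u * be.
      apply: (lim_norm_le cv) => N.
      have -> : S (sval u) (N + j.+1)%N - (2 * sval u j) *: v j =
          S (fun n => if n == j then - sval u n else sval u n) (N + j.+1)%N.
        have jN : j \in index_iota 0 (N + j.+1) by rewrite mem_index_iota; lia.
        rewrite /S !(bigD1_seq j)/= ?iota_uniq// eqxx addrAC -scalerBl.
        congr (_ *: _ + _); first by ring.
        by apply: eq_bigr => i /negPf ->.
      apply: sum_seg_norm => // [|n _]; first exact: c0_norm_ge0.
      by case: ifP => _; rewrite ?normrN; exact: c0_norm_ub.
    have := ler_normD (T u) (- (T u - (2 * sval u j) *: v j)).
    rewrite normrN subKr normrZ normrM ger0_norm//.
    have := ler_wpM2l (normr_ge0 (2 * sval u j)) (hv j); rewrite normrM ger0_norm//; lra.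
  have al0 : 0 < al by lra.
  suff : c0_norm u <= (`|T u| + c0_norm u * be) / (2 * al).
    by rewrite ler_pdivlMr; lra.
  by apply: c0_norm_le => j; rewrite ler_pdivlMr; [have := H j; lra|lra].
move=> r u w z E; apply: (cvg_unique (@norm_hausdorff _ _) (TP z)).
have -> : S (sval z) = (fun N => r *: S (sval u) N + S (sval w) N).
  apply/funext => N; rewrite /S scaler_sumr -big_split; apply: eq_bigr => n _ /=.
  by rewrite E scalerDl scalerA.
by apply: cvgD; [apply: cvgZr; exact: TP|exact: TP].
Qed.

(** The Kantorovich-Banach property, for sequences. *)
Definition kb_lattice := forall u : nat -> X, (forall n, u n <=| u n.+1) ->
  (exists M, forall n, `|u n| <= M) -> exists l : X, u @ \oo --> l.

Lemma vle_homo (u : nat -> X) : (forall n, u n <=| u n.+1) ->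
  forall n m, (n <= m)%N -> u n <=| u m.
Proof.
move=> H n m /subnK <-; elim: (m - n)%N => [|k IH]; first exact: (vle_refl HL).
exact: (vle_trans HL IH).
Qed.

(** If [u] diverges, its oscillation past [N] decreases to some K > 0. Past [N0] increments have
    norm at most 5K/4, and successive blocks of norm at least 3K/4 can be chosen there. Sums of
    blocks are dominated by single increments, and 5/4 < 2 * 3/4 as [c0_of_blocks] requires. *)
Lemma kb_of_not_c0 : ~ c0_iso_embeds X -> kb_lattice.
Proof.
move=> nc0 u u1 [M uM]; apply: contrapT => ncvg; apply: nc0.
have umono := vle_homo u1.
have [e [e0 He]] : exists e : R, 0 < e /\ forall N, exists n m,
    [/\ (N <= n)%N, (n <= m)%N & e < `|u m - u n|].
  apply: contrapT => H; apply/ncvg/cauchy_seq_cvg => e e0; apply: contrapT => H1.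
  apply: H; exists e; split=> // N; apply: contrapT => H2; apply: H1.
  exists N => n m Nn nm; rewrite leNgt; apply/negP => H3; apply: H2.
  by exists n, m.
pose S N := [set r | exists n m, [/\ (N <= n)%N, (n <= m)%N & r = `|u m - u n|]].
have S0 N : S N !=set0 by exists `|u N - u N|, N, N.
have Sub N : ubound (S N) (M + M).
  by move=> _ [n [m [_ _ ->]]]; apply: le_trans (ler_normB _ _) _; rewrite lerD.
have Ssup N : has_sup (S N) by split=> //; exists (M + M).
have Sg N n m : (N <= n)%N -> (n <= m)%N -> `|u m - u n| <= sup (S N).
  by move=> Nn nm; apply: ub_le_sup; [exists (M + M)|exists n, m].
have ge_e N : e <= sup (S N).
  by have [n [m [Nn nm H]]] := He N; apply: le_trans (ltW H) (Sg _ _ _ Nn nm).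
have gmono n m : (n <= m)%N -> sup (S m) <= sup (S n).
  move=> nm; apply: ge_sup => // _ [i [j [mi ij ->]]].
  by apply: Sg => //; exact: leq_trans mi.
have [K [eK KS HK]] := inf_nonincr_cvg ge_e gmono.
have K40 : 0 < K / 4 by lra.
have [N0 HN0] := HK _ K40.
have pick N : exists p : nat * nat,
    [/\ (N <= p.1)%N, (p.1 <= p.2)%N & K - K / 4 <= `|u p.2 - u p.1|].
  have [_ [n [m [Nn nm ->]]] Hnm] := sup_adherent K40 (Ssup N).
  by exists (n, m); split=> //=; have := KS N; lra.
pose p N := sval (cid (pick N)).
have pP N : [/\ (N <= (p N).1)%N, ((p N).1 <= (p N).2)%N &
    K - K / 4 <= `|u (p N).2 - u (p N).1|] by rewrite /p; case: cid.
(* Each block starts after the end of the preceding one. *)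
pose B i := iter i (fun q => p q.2) (p N0).
have B12 i : ((B i).1 <= (B i).2)%N by case: i => [|i]; case: (pP N0) => //; case: (pP (B i).2).
have B21 i : ((B i).2 <= (B i.+1).1)%N by case: (pP (B i).2).
have BN0 i : (N0 <= (B i).1)%N.
  elim: i => [|i IH]; first by case: (pP N0).
  exact: leq_trans IH (leq_trans (B12 i) (B21 i)).
pose v i := u (B i).2 - u (B i).1.
have v0 i : 0 <=| v i by rewrite /v; apply: (vle_eq HL (umono _ _ (B12 i))); vlin.
apply: (@c0_of_blocks v (K - K / 4) (K + K / 4)) => //; [| |lra|lra].
  by move=> [|i]; [case: (pP N0)|case: (pP (B i).2)].
move=> a b; have [ab|ba] := leqP a b; last first.
  by rewrite big_geq ?normr0; [lra|exact: ltnW].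
have [Bab Hv] : ((B a).1 <= (B b).1)%N /\
    \sum_(a <= i < b) v i <=| u (B b).1 - u (B a).1.
  rewrite -(subnK ab); elim: (b - a)%N => [|k [IH1 IH2]].
    by rewrite big_geq// subrr; split=> //; exact: (vle_refl HL).
  rewrite addSn; split; first exact: leq_trans IH1 (leq_trans (B12 _) (B21 _)).
  rewrite big_nat_recr ?leq_addl//; have := vle_addr HL (v (k + a)%N) IH2.
  move=> /(vle_trans HL); apply.
  by rewrite /v; apply: (vle_eq HL (umono _ _ (B21 (k + a)%N))); vlin.
apply: le_trans (HN0 N0 (leqnn _)); apply: le_trans (Sg N0 _ _ (BN0 a) Bab).
apply: (norm_le HL) => //; apply: (vle_trans HL (y := \sum_(a <= i < b) (0 : X))).
  by rewrite big1// ; exact: (vle_refl HL).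
exact: vle_sum.
Qed.

End C0Embedding.

(** * Hahn-Banach and positive functionals *)

Section HahnBanach.
Variables (R : realType) (X : completeNormedModType R).
Implicit Types (p q : X -> R) (x y : X) (t : R).

Definition sublinear p := (forall x y, p (x + y) <= p x + p y) /\
  (forall t x, 0 <= t -> p (t *: x) <= t * p x).

Lemma sublinear0 p : sublinear p -> p 0 = 0.
Proof.
move=> [pD pZ]; apply/eqP; rewrite eq_le; apply/andP; split.
  by have := pZ 0 0 (lexx _); rewrite scale0r mul0r.
by have := pD 0 0; rewrite addr0; lra.
Qed.

Lemma sublinear_ge p x y : sublinear p -> p x - p (- y) <= p (x + y).
Proof. by move=> [pD _]; have := pD (x + y) (- y); rewrite addrK; lra. Qed.

(** For sublinear [q] this is a sublinear functional below [q], with value at most [- q a] at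
    [- a]. *)
Definition slope q (a x : X) : R := inf [set q (x + t *: a) - t * q a | t in [set t | 0 <= t]].

Lemma slope_has_inf q a x : sublinear q ->
  has_inf [set q (x + t *: a) - t * q a | t in [set t | 0 <= t]].
Proof.
move=> sq; split; first by exists (q (x + 0 *: a) - 0 * q a), 0 => //=.
exists (- q (- x)) => _ [t /= t0 <-].
have := sublinear_ge (t *: a + x) (- x) sq; rewrite opprK addrK.
have := sublinear_ge (t *: a) x sq; rewrite addrC => H _.
have := sq.1 (- x) (x + t *: a); rewrite addKr => H2.
(* Homogeneity is an inequality in [sublinear]; the scalar [t^-1] reverses it. *)
suff : t * q a <= q (t *: a) by lra.
have [->|tN0] := eqVneq t 0; first by rewrite mul0r scale0r sublinear0.
have tp : 0 < t by rewrite lt_neqAle eq_sym tN0.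
have := sq.2 t^-1 (t *: a); rewrite scalerA mulVf// scale1r invr_ge0 => /(_ t0).
by rewrite mulrC ler_pdivlMr// mulrC.
Qed.

Lemma slope_le q a x t : sublinear q -> 0 <= t -> slope q a x <= q (x + t *: a) - t * q a.
Proof.
move=> sq t0; apply: ge_inf; last by exists t.
by case: (slope_has_inf a x sq).
Qed.

Lemma slope_adh q a x (e : R) : sublinear q -> 0 < e ->
  exists2 t, 0 <= t & q (x + t *: a) - t * q a < slope q a x + e.
Proof.
move=> sq e0; have [_ [t t0 <-] H] := inf_adherent e0 (slope_has_inf a x sq).
by exists t.
Qed.

Lemma slope_sublinear q a : sublinear q -> sublinear (slope q a).
Proof.
move=> sq; split=> [x y|t x t0].
  apply/ler_addgt0Pr => e e0; have e20 : 0 < e / 2 by lra.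
  have [t t0 Ht] := slope_adh a x sq e20; have [s s0 Hs] := slope_adh a y sq e20.
  have ts0 : 0 <= t + s by lra.
  have := slope_le a (x + y) sq ts0.
  have := sq.1 (x + t *: a) (y + s *: a).
  have -> : x + t *: a + (y + s *: a) = x + y + (t + s) *: a by vlin.
  lra.
have [->|tN0] := eqVneq t 0.
  rewrite scale0r mul0r; have := slope_le a 0 sq (lexx 0).
  by rewrite scale0r addr0 mul0r subr0 (sublinear0 sq).
have tp : 0 < t by rewrite lt_neqAle eq_sym tN0.
rewrite mulrC -ler_pdivrMr//; apply/ler_addgt0Pr => e e0; rewrite ler_pdivrMr//.
have [s s0 Hs] := slope_adh a x sq e0.
have := slope_le a (t *: x) sq (mulr_ge0 t0 s0).
rewrite -scalerA -scalerDr; have := sq.2 t (x + s *: a) t0.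
have : t * (q (x + s *: a) - s * q a) <= t * (slope q a x + e) by rewrite ler_pM2l// ltW.
lra.
Qed.

(* A minimal sublinear functional is additive, since it equals all its slopes. *)
Lemma minimal_sublinear p : sublinear p ->
  exists q, [/\ sublinear q, forall x, q x <= p x & forall x y, q (x + y) = q x + q y].
Proof.
move=> sp; pose T := {q : X -> R | sublinear q /\ forall x, q x <= p x}.
(* The order is reversed, so that Zorn's lemma gives a minimal functional; the pointwise infimum of
   a chain is the bound it asks for. *)
have [|q r s|q r|A tA|q qmin] := @Zorn T (fun f g : T => `[< forall x, sval g x <= sval f x >]).
- by move=> q; apply/asboolP.
- by move=> /asboolP H1 /asboolP H2; apply/asboolP => x; exact: le_trans (H2 x) (H1 x).
- case: q r => [q Hq] [r Hr] /asboolP H1 /asboolP H2; apply: eq_exist.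
  by apply/funext => x; apply/eqP; rewrite eq_le H1 H2.
- have [[q0 Aq0]|A0] := pselect (A !=set0); last first.
    by exists (exist _ p (conj sp (fun x => lexx (p x)))) => s As; case: A0; exists s.
  pose S x := [set sval q x | q in A].
  have Sinf x : has_inf (S x).
    split; first by exists (sval q0 x), q0.
    exists (- p (- x)) => _ [q Aq <-]; have [sq qp] := svalP q.
    have := sq.1 x (- x); rewrite subrr sublinear0//; have := qp (- x); lra.
  have Sle (q : T) x : A q -> inf (S x) <= sval q x.
    by move=> Aq; apply: ge_inf; [case: (Sinf x)|exists q].
  have sS : sublinear (fun x => inf (S x)).
    split=> [x y|t x t0].
      apply/ler_addgt0Pr => e e0; have e20 : 0 < e / 2 by lra.
      have [_ [q Aq <-] Hq] := inf_adherent e20 (Sinf x).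
      have [_ [r Ar <-] Hr] := inf_adherent e20 (Sinf y).
      (* Two members of the chain are comparable, and the smaller one serves both [x] and [y]. *)
      have [/asboolP H|/asboolP H] := tA q r Aq Ar.
        by have := Sle r (x + y) Ar; have := (svalP r).1.1 x y; have := H x; lra.
      by have := Sle q (x + y) Aq; have := (svalP q).1.1 x y; have := H y; lra.
    have [->|tN0] := eqVneq t 0.
      rewrite scale0r mul0r; have := Sle q0 0 Aq0.
      by rewrite (sublinear0 (svalP q0).1).
    have tp : 0 < t by rewrite lt_neqAle eq_sym tN0.
    rewrite mulrC -ler_pdivrMr//; apply: lb_le_inf; first by case: (Sinf x).
    move=> _ [q Aq <-]; rewrite ler_pdivrMr// mulrC.
    exact: le_trans (Sle q _ Aq) ((svalP q).1.2 t x t0).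
  have Sp x : inf (S x) <= p x by apply: le_trans (Sle q0 x Aq0) ((svalP q0).2 x).
  exists (exist _ (fun x => inf (S x)) (conj sS Sp)) => q Aq; apply/asboolP => x /=.
  exact: Sle.
have [sq qp] := svalP q; exists (sval q); split=> // x y.
have sl := slope_sublinear y sq.
have slq z : slope (sval q) y z <= sval q z.
  by have := slope_le y z sq (lexx 0); rewrite scale0r addr0 mul0r subr0.
have slp z : slope (sval q) y z <= p z := le_trans (slq z) (qp z).
(* By minimality [q] equals its slope along [y], whence q x <= q (x + y) - q y. *)
have /(congr1 sval)/= E : exist _ (slope (sval q) y) (conj sl slp) = q.
  by apply: qmin; apply/asboolP.
apply/eqP; rewrite eq_le sq.1/=.
by have := slope_le y x sq ler01; rewrite E scale1r mul1r; lra.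
Qed.

(** A minimal functional [q] below the slope of [p] along [x0] is additive and satisfies q (- x0) <=
    - p x0. *)
Lemma hahn_banach p x0 : sublinear p ->
  exists q, [/\ forall x y, q (x + y) = q x + q y,
    forall t x, 0 <= t -> q (t *: x) = t * q x,
    forall x, q x <= p x & q x0 = p x0].
Proof.
move=> sp; have [q [sq qs qD]] := minimal_sublinear (slope_sublinear x0 sp).
have q0 := sublinear0 sq.
have qp x : q x <= p x.
  by have := slope_le x0 x sp (lexx 0); rewrite scale0r addr0 mul0r subr0; apply: le_trans.
have qN x : q (- x) = - q x by have := qD x (- x); rewrite subrr q0; lra.
exists q; split=> // [t x t0|].
  apply/eqP; rewrite eq_le sq.2//=.
  by have := sq.2 t (- x) t0; rewrite scalerN !qN; lra.
apply/eqP; rewrite eq_le qp/=; have := slope_le x0 (- x0) sp ler01.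
by rewrite scale1r mul1r addNr (sublinear0 sp); have := qs (- x0); rewrite qN; lra.
Qed.

End HahnBanach.

(** * Positive functionals *)

Section PositiveFunctionals.
Variables (R : realType) (X : completeNormedModType R) (le : X -> X -> Prop).
Hypothesis HL : is_banach_lattice le.
Local Notation "x <=| y" := (le x y) (at level 70).

(** Domination by [pn] encodes positivity and norm at most one together. *)
Definition posfun (h : X -> R) := [/\ forall x y, h (x + y) = h x + h y,
  forall t x, 0 <= t -> h (t *: x) = t * h x & forall x, h x <= pn le x].

Section Theory.
Variables (h : X -> R) (hP : posfun h).

Lemma posfunD x y : h (x + y) = h x + h y. Proof. by case: hP. Qed.
Lemma posfunZ t x : 0 <= t -> h (t *: x) = t * h x. Proof. by case: hP => _ H _; exact: H. Qed.
Lemma posfun0 : h 0 = 0. Proof. by have := posfunD 0 0; rewrite addr0; lra. Qed.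
Lemma posfunN x : h (- x) = - h x.
Proof. by have := posfunD x (- x); rewrite subrr posfun0; lra. Qed.
Lemma posfunB x y : h (x - y) = h x - h y.
Proof. by rewrite posfunD posfunN. Qed.
Lemma posfun_mono x y : x <=| y -> h x <= h y.
Proof.
by move=> xy; case: hP => _ _ /(_ (x - y)); rewrite (vle_pn HL xy) posfunB; lra.
Qed.
Lemma posfun_ge0 x : 0 <=| x -> 0 <= h x.
Proof. by move/posfun_mono; rewrite posfun0. Qed.
Lemma posfun_le_norm x : h x <= `|x|.
Proof. by case: hP => _ _ H; apply: le_trans (H x) (pn_le_norm HL x). Qed.
Lemma posfun_sum (I : Type) (r : seq I) (P : pred I) (F : I -> X) :
  h (\sum_(i <- r | P i) F i) = \sum_(i <- r | P i) h (F i).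
Proof. exact: (big_morph h posfunD posfun0). Qed.
Lemma posfun_lim (s : nat -> X) (l : X) (a : R) N : s @ \oo --> l ->
  (forall n, (N <= n)%N -> h (s n) <= a) -> h l <= a.
Proof.
move=> /cvg_seqP sl H; apply/ler_addgt0Pr => e e0; have [M HM] := sl e e0.
have := HM _ (leq_maxl M N); rewrite distrC.
have := posfun_le_norm (l - s (maxn M N)); rewrite posfunB.
by have := H _ (leq_maxr M N); lra.
Qed.
End Theory.

Lemma pn_sublinear : sublinear (pn le).
Proof. by split; [exact: pn_add|move=> t x; exact: pn_scale]. Qed.

Lemma separableP : separable X ->
  exists f : nat -> X, forall x (e : R), 0 < e -> exists n, `|f n - x| < e.
Proof.
move=> [f fP]; exists f => x e e0.
have : closure (range f) x by rewrite fP.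
move=> /(_ (ball x e) (nbhsx_ballx _ _ e0)) [_ [[n _ <-]]].
by rewrite -ball_normE /ball_/= distrC; exists n.
Qed.

(** Norm the positive part of each member of a dense sequence. If [f n] is close to x >= 0 and [h n]
    kills [x], then [h n] is small at the positive part of [f n], which is therefore small in norm,
    and so is [x]. *)
Lemma separating_posfuns : separable X ->
  exists h : nat -> X -> R, (forall n, posfun (h n)) /\
    forall x, 0 <=| x -> (forall n, h n x = 0) -> x = 0.
Proof.
move=> /separableP[f fP].
have ex n : exists q, posfun q /\ q (ps le (f n)) = pn le (f n).
  have [q [q1 q2 q3 q4]] := hahn_banach (ps le (f n)) pn_sublinear.
  by exists q; split=> //; rewrite q4 pn_id//; exact: ps_ge0.
pose h n := sval (cid (ex n)).
have hP n : posfun (h n) /\ h n (ps le (f n)) = pn le (f n) by rewrite /h; case: cid.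
exists h; split=> [n|x x0 hx]; first by case: (hP n).
apply/eqP; rewrite -normr_eq0 -(pn_id HL x0) eq_le pn_ge0 andbT.
apply/ler_addgt0Pr => e e0; rewrite add0r; have e20 : 0 < e / 2 by lra.
have [n fn] := fP x _ e20.
have := pn_add HL (f n) (x - f n); rewrite addrCA subrr addr0.
have := pn_le_norm HL (x - f n); rewrite distrC.
have [hn E] := hP n; rewrite -E.
have : h n (ps le (f n)) <= h n (x + ps le (f n - x)).
  apply: posfun_mono => //.
  have := ps_add HL x (f n - x); rewrite addrCA subrr addr0 (ps_id HL x0).
  by [].
rewrite posfunD// hx add0r => H1 H2 H3.
have := posfun_le_norm hn (ps le (f n - x)).
have := pn_le_norm HL (f n - x); rewrite -/(pn le (f n - x)).
lra.
Qed.

End PositiveFunctionals.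

(** * Dyadic averages of order bounded sequences *)

Lemma inv_nat_small (R : realType) (e : R) : 0 < e ->
  exists N, forall n, (N <= n)%N -> n.+1%:R^-1 <= e.
Proof.
move=> e0; exists (Num.bound e^-1) => n Nn.
have e1 : 0 <= e^-1 by rewrite invr_ge0 ltW.
rewrite -[e]invrK lef_pV2 ?posrE ?invr_gt0//; apply: ltW.
apply: lt_le_trans (archi_boundP e1) _; rewrite ler_nat; lia.
Qed.

Lemma geo_sum_le1 (R : realType) n : \sum_(0 <= i < n) (2^-1 : R) ^+ i.+1 <= 1.
Proof.
suff -> : \sum_(0 <= i < n) (2^-1 : R) ^+ i.+1 = 1 - 2^-1 ^+ n.
  by rewrite gerBl exprn_ge0// invr_ge0.
elim: n => [|n IH]; first by rewrite big_geq// expr0 subrr.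
by rewrite big_nat_recr//= IH exprS; field.
Qed.

(** * Simultaneous near-minimisers of countably many convex functionals *)

Section NearMinimizers.
Variables (R : realType) (D : Type) (mid : D -> D -> D) (DN : nat -> D -> Prop).
Variable (psi : nat -> D -> R).
Hypothesis psi0 : forall i d, 0 <= psi i d.
Hypothesis psi_bound : forall i, exists B, forall d, psi i d <= B.
Hypothesis psi_mid : forall i a b, 2 * psi i (mid a b) <= psi i a + psi i b.
Hypothesis DN0 : forall N, exists d, DN N d.
Hypothesis DN_anti : forall N M d, (N <= M)%N -> DN M d -> DN N d.
Hypothesis DN_mid : forall N a b, DN N a -> DN N b -> DN N (mid a b).

(** Let [c N] nearly minimise a weighted sum [Psi] of the [psi i] on [DN N]. The infima increase
    with [N] and converge, so the midpoint of [c n] and [c m], which stays in the tail, cannot lower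
    [Psi] by much. All convexity defects are nonnegative, so each of them is small. *)
Lemma near_minimizers : exists c : nat -> D, (forall N, DN N (c N)) /\
  forall i (e : R), 0 < e -> exists N, forall n m, (N <= n)%N -> (N <= m)%N ->
    psi i (c n) + psi i (c m) - 2 * psi i (mid (c n) (c m)) <= e.
Proof.
have [d0 _] := DN0 0%N.
pose B i := sval (cid (psi_bound i)).
have psiB i d : psi i d <= B i by rewrite /B; case: cid.
have B0 i : 0 <= B i := le_trans (psi0 i d0) (psiB i d0).
(* The weights make every partial sum of [Psi] at most 1. *)
pose w i := 2^-1 ^+ i.+1 / (B i + 1).
have w0 i : 0 < w i.
  by rewrite divr_gt0 ?exprn_gt0 ?invr_gt0//; have := B0 i; lra.
pose S n d := \sum_(0 <= i < n) w i * psi i d.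
have S1 n d : S n d <= 1.
  apply: le_trans (geo_sum_le1 R n); apply: ler_sum => i _.
  rewrite /w mulrAC -mulrA ler_piMr ?exprn_ge0 ?invr_ge0//.
  rewrite ler_pdivrMr; last by have := B0 i; lra.
  by have := psiB i d; lra.
have Smono n m d : (n <= m)%N -> S n d <= S m d.
  move=> nm; rewrite /S (@big_cat_nat _ _ _ n 0 m)//= lerDl.
  by apply: sumr_ge0 => i _; rewrite mulr_ge0// ltW.
pose Psi d := sup (range (S ^~ d)).
have PsiE d : has_sup (range (S ^~ d)).
  by split; [exists (S 0%N d), 0%N|exists 1 => _ [n _ <-]].
have SPsi n d : S n d <= Psi d by apply: ub_le_sup; [case: (PsiE d)|exists n].
have Psi0 d : 0 <= Psi d by apply: le_trans (SPsi 0%N d); rewrite /S big_geq.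
have Psi1 d : Psi d <= 1 by apply: ge_sup => [|_ [n _ <-]//]; case: (PsiE d).
have defect i a b :
    w i * (psi i a + psi i b - 2 * psi i (mid a b)) <= Psi a + Psi b - 2 * Psi (mid a b).
  suff : Psi (mid a b) <=
    (Psi a + Psi b - w i * (psi i a + psi i b - 2 * psi i (mid a b))) / 2 by lra.
  apply: ge_sup => [|_ [n _ <-]]; first by case: (PsiE (mid a b)).
  apply: le_trans (Smono _ (maxn n i.+1) _ (leq_maxl _ _)) _.
  set m := maxn _ _; have im : (i < m)%N by rewrite leq_max ltnSn orbT.
  suff : w i * (psi i a + psi i b - 2 * psi i (mid a b)) <=
      S m a + S m b - 2 * S m (mid a b) by have := SPsi m a; have := SPsi m b; lra.
  have -> : S m a + S m b - 2 * S m (mid a b) =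
      \sum_(0 <= j < m) w j * (psi j a + psi j b - 2 * psi j (mid a b)).
    rewrite /S mulr_sumr -big_split -sumrB; apply: eq_bigr => j _ /=; ring.
  rewrite (bigD1_seq i) ?mem_index_iota ?iota_uniq//= lerDl; apply: sumr_ge0 => j _.
  by rewrite mulr_ge0 ?(ltW (w0 j))//; have := psi_mid j a b; lra.
pose I N := inf [set Psi d | d in DN N].
have Iinf N : has_inf [set Psi d | d in DN N].
  by split; [have [d dN] := DN0 N; exists (Psi d), d|exists 0 => _ [d _ <-]].
have IPsi N d : DN N d -> I N <= Psi d.
  by move=> dN; apply: ge_inf; [case: (Iinf N)|exists d].
(* The infima [I N] increase, so the result on nonincreasing sequences is applied to their
   opposites; the limit of [I] is [- K]. *)
have [K [_ IK HK]] : exists K : R, [/\ -1 <= K, forall n, K <= - I n &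
    forall e : R, 0 < e -> exists N, forall n, (N <= n)%N -> - I n <= K + e].
  apply: inf_nonincr_cvg => [n|n m nm].
    rewrite lerN2; have [d dn] := DN0 n; exact: le_trans (IPsi n d dn) (Psi1 d).
  rewrite lerN2; apply: lb_le_inf => [|_ [d dm <-]]; first by case: (Iinf m).
  by apply: IPsi; exact: DN_anti dm.
have exc N : exists d, DN N d /\ Psi d <= I N + N.+1%:R^-1.
  have p0 : 0 < (N.+1%:R^-1 : R) by rewrite invr_gt0.
  have [_ [d dN <-] H] := inf_adherent p0 (Iinf N).
  by exists d; split=> //; exact: ltW.
pose c N := sval (cid (exc N)).
have cP N : DN N (c N) /\ Psi (c N) <= I N + N.+1%:R^-1 by rewrite /c; case: cid.
exists c; split=> [N|i e e0]; first by case: (cP N).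
(* Four errors of this size: one for each of [c n] and [c m], and two for the gap between [I] and
   its limit. *)
have e'0 : 0 < w i * e / 4 by rewrite divr_gt0// mulr_gt0.
have [N1 HN1] := HK _ e'0; have [N2 HN2] := inv_nat_small e'0.
exists (maxn N1 N2) => n m Nn Nm; rewrite -(ler_pM2l (w0 i)).
apply: le_trans (defect i _ _) _.
have Imid : I (maxn N1 N2) <= Psi (mid (c n) (c m)).
  by apply: IPsi; apply: DN_mid; [exact: DN_anti Nn (cP n).1|exact: DN_anti Nm (cP m).1].
have := HN1 (maxn N1 N2) (leq_maxl _ _).
have := HN2 n (leq_trans (leq_maxr _ _) Nn); have := HN2 m (leq_trans (leq_maxr _ _) Nm).
have [_] := cP n; have [_] := cP m; have := IK n; have := IK m.
by move: (n.+1%:R^-1) (m.+1%:R^-1) => a b; lra.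
Qed.

End NearMinimizers.

Section DyadicAverages.
Variable R : realType.

(* A finitely supported dyadic probability on [T], encoded as a tree of midpoints. *)
Inductive dyavg (T : Type) := Pt of T | Mid of dyavg T & dyavg T.

Fixpoint ev (V : lmodType R) (T : Type) (b : dyavg T) (y : T -> V) : V := match b with
  | Pt i => y i | Mid a c => 2^-1 *: (ev a y + ev c y) end.

Fixpoint dall (T : Type) (P : T -> Prop) (b : dyavg T) : Prop := match b with
  | Pt i => P i | Mid a c => dall P a /\ dall P c end.

Fixpoint dbind (T U : Type) (b : dyavg T) (k : T -> dyavg U) : dyavg U := match b with
  | Pt i => k i | Mid a c => Mid (dbind a k) (dbind c k) end.

Definition dmap (T U : Type) (g : T -> U) (b : dyavg T) := dbind b (fun i => Pt (g i)).

Lemma ev_bind (V : lmodType R) (T U : Type) (b : dyavg T) (k : T -> dyavg U) (y : U -> V) :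
  ev (dbind b k) y = ev b (fun i => ev (k i) y).
Proof. by elim: b => //= a -> c ->. Qed.

Lemma dall_bind (T U : Type) (b : dyavg T) (k : T -> dyavg U) (P : U -> Prop) :
  dall P (dbind b k) <-> dall (fun i => dall P (k i)) b.
Proof. by elim: b => //= a IHa c IHc; tauto. Qed.

Lemma dall_imp (T : Type) (P Q : T -> Prop) (b : dyavg T) :
  (forall i, P i -> Q i) -> dall P b -> dall Q b.
Proof. by move=> PQ; elim: b => /= [i /PQ//|a IHa c IHc [/IHa ? /IHc]]. Qed.

Lemma dallT (T : Type) (P : T -> Prop) (b : dyavg T) : (forall i, P i) -> dall P b.
Proof. by move=> H; elim: b => /=. Qed.

Lemma dall_and (T : Type) (P Q : T -> Prop) (b : dyavg T) :
  dall P b -> dall Q b -> dall (fun i => P i /\ Q i) b.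
Proof. by elim: b => //= a IHa c IHc [/IHa + /IHc +] [] => H1 H2 /H1 ? /H2. Qed.

Lemma dall_exch (T U : Type) (P : T -> U -> Prop) (a : dyavg T) (b : dyavg U) :
  dall (fun i => dall (P i) b) a -> dall (fun j => dall (P ^~ j) a) b.
Proof.
elim: a => //= a IHa c IHc [/IHa {}IHa /IHc {}IHc]; exact: dall_and.
Qed.

Lemma evZ (V : lmodType R) (T : Type) (b : dyavg T) (y : T -> V) (r : R) :
  ev b (fun i => r *: y i) = r *: ev b y.
Proof. by elim: b => //= a -> c ->; rewrite -scalerDr !scalerA mulrC. Qed.

Lemma evD (V : lmodType R) (T : Type) (b : dyavg T) (y z : T -> V) :
  ev b (fun i => y i + z i) = ev b y + ev b z.
Proof. by elim: b => //= a -> c ->; rewrite addrACA scalerDr. Qed.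

Lemma evN (V : lmodType R) (T : Type) (b : dyavg T) (y : T -> V) :
  ev b (fun i => - y i) = - ev b y.
Proof. by elim: b => //= a -> c ->; rewrite -opprD scalerN. Qed.

Lemma evB (V : lmodType R) (T : Type) (b : dyavg T) (y z : T -> V) :
  ev b (fun i => y i - z i) = ev b y - ev b z.
Proof. by rewrite evD evN. Qed.

Lemma ev_const (V : lmodType R) (T : Type) (b : dyavg T) (x : V) : ev b (fun=> x) = x.
Proof.
elim: b => //= a -> c ->; rewrite -[X in X + _]scale1r -[X in _ + X]scale1r -scalerDl.
by rewrite scalerA [_ * _](_ : _ = 1) ?scale1r//; field.
Qed.

Lemma ev_exch (V : lmodType R) (T U : Type) (a : dyavg T) (b : dyavg U) (y : T -> U -> V) :
  ev a (fun i => ev b (y i)) = ev b (fun j => ev a (y ^~ j)).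
Proof.
by elim: a => //= a -> c ->; rewrite -evD -evZ.
Qed.

End DyadicAverages.

Section AveragesInLattice.
Variables (R : realType) (X : completeNormedModType R) (le : X -> X -> Prop).
Hypothesis HL : is_banach_lattice le.
Local Notation "x <=| y" := (le x y) (at level 70).
Variable (T : Type).
Implicit Types (b : dyavg T) (y z : T -> X).

Let h2 : (0 : R) <= 2^-1. Proof. lra. Qed.

Lemma ev_mono b (P : T -> Prop) y z : dall P b -> (forall i, P i -> y i <=| z i) ->
  ev b y <=| ev b z.
Proof.
move=> + H; elim: b => /= [i /H//|a IHa c IHc [/IHa {}IHa /IHc {}IHc]].
exact: (vle_scale HL h2 (vle_add HL IHa IHc)).
Qed.

Lemma ev_ge0 b y : (forall i, 0 <=| y i) -> 0 <=| ev b y.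
Proof.
move=> H; rewrite -(ev_const b 0); apply: (@ev_mono _ (fun=> True)) => //.
exact: dallT.
Qed.

Lemma ev_ab b y : ab le (ev b y) <=| ev b (fun i => ab le (y i)).
Proof.
elim: b => /= [i|a IHa c IHc]; first exact: (vle_refl HL).
apply: (vle_trans HL (ab_scale HL _ _)); rewrite ger0_norm//.
apply: (vle_scale HL h2); apply: (vle_trans HL (ab_add HL _ _)).
exact: vle_add.
Qed.

Lemma pn_ev b (P : T -> Prop) y e : dall P b -> (forall i, P i -> pn le (y i) <= e) ->
  pn le (ev b y) <= e.
Proof.
move=> + H; elim: b => /= [i /H//|a IHa c IHc [/IHa {}IHa /IHc {}IHc]].
apply: le_trans (pn_scale HL _ h2) _; have := pn_add HL (ev a y) (ev c y); lra.
Qed.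

Lemma norm_ev b (P : T -> Prop) y e : dall P b -> (forall i, P i -> `|y i| <= e) ->
  `|ev b y| <= e.
Proof.
move=> + H; elim: b => /= [i /H//|a IHa c IHc [/IHa {}IHa /IHc {}IHc]].
rewrite normrZ ger0_norm//; have := ler_normD (ev a y) (ev c y); lra.
Qed.

End AveragesInLattice.

(** * Convergence of averages in order intervals *)

Section OrderBounded.
Variables (R : realType) (X : completeNormedModType R) (le : X -> X -> Prop).
Hypothesis HL : is_banach_lattice le.
Local Notation "x <=| y" := (le x y) (at level 70).
Hypothesis KB : kb_lattice le.
Variable h : nat -> X -> R.
Hypothesis hP : forall k, posfun le (h k).
Hypothesis hsep : forall x, 0 <=| x -> (forall k, h k x = 0) -> x = 0.

(** In an order interval the functionals [h k] control the norm. Otherwise there are [w K] of norm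
    above [e] on which they tend to 0 geometrically. The suprema [Z N] of the tails exist by [KB]
    and decrease in norm to a vector killed by every [h k], that is to 0, although w N <= Z N. *)
Lemma order_bounded_small (u : X) (e : R) : 0 < e -> exists K (d : R), 0 < d /\
  forall w, 0 <=| w -> w <=| u -> (forall k, (k <= K)%N -> h k w <= d) -> `|w| <= e.
Proof.
move=> e0; apply: contrapT => Hn.
have exw K : exists w, [/\ 0 <=| w, w <=| u, forall k, (k <= K)%N -> h k w <= 2^-1 ^+ K & e < `|w|].
  apply: contrapT => H; apply: Hn; exists K, (2^-1 ^+ K); split=> [|w w0 wu hw].
    by rewrite exprn_gt0// invr_gt0.
  by rewrite leNgt; apply/negP => we; apply: H; exists w.
pose w K := sval (cid (exw K)).
have wP K : [/\ 0 <=| w K, w K <=| u, forall k, (k <= K)%N -> h k (w K) <= 2^-1 ^+ K & e < `|w K|].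
  by rewrite /w; case: cid.
(* [W N m] is the supremum of w N, ..., w (N + m). *)
pose W N := fix W m := match m with 0 => w N | m.+1 => sup2 le (W m) (w (N + m.+1)%N) end.
have W0 N m : 0 <=| W N m.
  case: m => [|m] /=; first by case: (wP N).
  by apply: (vle_trans HL _ (sup2r HL _ _)); case: (wP (N + m.+1)%N).
have Wu N m : W N m <=| u.
  by elim: m => [|m IH] /=; [case: (wP N)|apply: (sup2_lub HL) => //; case: (wP (N + m.+1)%N)].
have Wbd N : exists M, forall m, `|W N m| <= M.
  by exists `|u| => m; exact: (norm_le HL).
have Wlim N : exists l : X, W N @ \oo --> l by apply: KB => // m; exact: (sup2l HL).
pose Z N := sval (cid (Wlim N)).
have ZP N : W N @ \oo --> Z N by rewrite /Z; case: cid.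
have WZ N m : W N m <=| Z N.
  apply: (vle_lim HL (N := m) (ZP N)) => n mn; apply: (vle_homo HL) mn => k.
  exact: (sup2l HL).
have wZ N n : (N <= n)%N -> w n <=| Z N.
  move=> /subnKC <-; case: (n - N)%N => [|m]; first by rewrite addn0; exact: WZ N 0.
  by apply: (vle_trans HL _ (WZ N m.+1)); exact: (sup2r HL).
have Zle N z : (forall n, (N <= n)%N -> w n <=| z) -> Z N <=| z.
  move=> H; apply: (vlim_le HL (N := 0%N) (ZP N)) => m _.
  elim: m => [|m IH] /=; first exact: H.
  by apply: (sup2_lub HL) => //; apply: H; rewrite leq_addr.
have Zu N : Z N <=| u by apply: Zle => n _; case: (wP n).
have Z0 N : 0 <=| Z N by apply: (vle_trans HL (W0 N 0%N)); exact: WZ.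
have hZ k N : (k <= N)%N -> h k (Z N) <= 2 * 2^-1 ^+ N.
  move=> kN; apply: (posfun_lim HL (hP k) (N := 0%N) (ZP N)) => m _.
  (* The subtracted term, a tail of the geometric series, makes the induction on [m] close. *)
  suff : h k (W N m) <= 2 * 2^-1 ^+ N - 2^-1 ^+ (N + m).
    have : 0 <= (2^-1 : R) ^+ (N + m) by rewrite exprn_ge0 ?invr_ge0.
    lra.
  elim: m => [|m IH] /=.
    by rewrite addn0; have [_ _ /(_ k kN)] := wP N; lra.
  have wk := wP (N + m.+1)%N; have [w0 _ /(_ k) hw _] := wk.
  have : sup2 le (W N m) (w (N + m.+1)%N) <=| W N m + w (N + m.+1)%N.
    apply: (sup2_lub HL); first by apply: (vle_eq HL w0); rewrite addrAC subrr add0r subr0.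
    by apply: (vle_eq HL (W0 N m)); rewrite addrK subr0.
  move=> /(posfun_mono HL (hP k)); rewrite (posfunD (hP k)).
  have := hw (leq_trans kN (leq_addr _ _)); rewrite addnS exprS; lra.
have Zdec N : - Z N <=| - Z N.+1.
  by apply: (vle_opp HL); apply: Zle => n /ltnW; exact: wZ.
have [l Zl] : exists l : X, (fun N => - Z N) @ \oo --> l.
  by apply: KB Zdec _; exists `|u| => N; rewrite normrN; exact: (norm_le HL).
have lZ N : - l <=| Z N.
  rewrite -[Z N]opprK; apply: (vle_opp HL); apply: (vle_lim HL (N := N) Zl) => n Nn.
  exact: (vle_homo HL Zdec Nn).
have l0 : 0 <=| - l.
  rewrite -oppr0; apply: (vle_opp HL); apply: (vlim_le HL (N := 0%N) Zl) => n _.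
  by rewrite -oppr0; exact: (vle_opp HL).
have lz : - l = 0.
  apply: hsep => // k; apply/eqP; rewrite eq_le (posfun_ge0 HL (hP k))// andbT.
  apply/ler_addgt0Pr => d d0; rewrite add0r.
  have d20 : 0 < d / 2 by lra.
  have [N HN] : exists N, 2^-1 ^+ (maxn k N) <= d / 2.
    have [N HN] := inv_nat_small d20; exists N; apply: le_trans (HN (maxn k N) (leq_maxr _ _)).
    rewrite exprVn lef_pV2 ?posrE ?exprn_gt0// -natrX ler_nat; exact: ltn_expl.
  apply: le_trans (posfun_mono HL (hP k) (lZ (maxn k N))) _.
  by apply: le_trans (hZ _ _ (leq_maxl _ _)) _; lra.
have /cvg_seqP/(_ _ e0)[N /(_ N (leqnn N))] := Zl.
rewrite -opprD normrN; have -> : Z N + l = Z N by rewrite -[l]opprK lz oppr0 addr0.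
have [w0 _ _] := wP N.
by have := norm_le HL w0 (wZ N N (leqnn N)); lra.
Qed.

(** The two parts of [v] are disjoint: [ps le v - y] still bounds [v] and 0 from above. *)
Lemma disjoint_le0 (y v : X) : y <=| ps le v -> y <=| ps le (- v) -> y <=| 0.
Proof.
rewrite (psN HL) => H1 H2.
have : ps le v <=| ps le v - y.
  apply: (sup2_lub HL); first by apply: (vle_eq HL H2); vlin.
  by apply: (vle_eq HL H1); vlin.
by move=> H; apply: (vle_eq HL H); vlin.
Qed.

(** For numbers: the distance from [s] to the grid 0, e, ..., n e is at most [e] plus the overshoot
    of [s] beyond the grid. In a lattice the induction uses that the positive and negative parts of
    s - n e are disjoint. *)
Lemma grid_le (s e w : X) n : 0 <=| s -> 0 <=| e ->
  (forall i, (i <= n)%N -> w <=| ab le (s - i%:R *: e)) -> w <=| e + ps le (s - n%:R *: e).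
Proof.
move=> s0 e0; elim: n => [|n IH] H.
  have := H 0%N (leqnn _); rewrite scale0r subr0 (ab_id HL)// => H0.
  apply: (vle_trans HL H0); apply: (vle_trans HL (ps_ge HL s)).
  by apply: (vle_eq HL e0); vlin.
have {}IH := IH (fun i ni => H i (leqW ni)).
have {H} := H n.+1 (leqnn _).
have -> : s - n.+1%:R *: e = s - n%:R *: e - e by rewrite -natr1; vlin.
move: (s - n%:R *: e) IH => v H1; rewrite (ab_ps HL) => H2.
have Hy : w - e - ps le (v - e) <=| 0.
  apply: (@disjoint_le0 _ v).
    by apply: (vle_eq HL (vle_add HL H1 (ps_ge0 HL (v - e)))); vlin.
  have : ps le (- (v - e)) <=| ps le (- v) + e.
    apply: (ps_le HL); last by apply: (vle_eq HL (ps_ge HL (- v))); vlin.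
    by apply: (vle_eq HL (vle_add HL (ps_ge0 HL (- v)) e0)); vlin.
  move=> /(vle_add HL H2) H3; apply: (vle_eq HL H3); vlin.
by apply: (vle_eq HL Hy); vlin.
Qed.

Lemma vsum_ge0 (I : Type) (r : seq I) (P : pred I) (F : I -> X) :
  (forall i, P i -> 0 <=| F i) -> 0 <=| \sum_(i <- r | P i) F i.
Proof.
move=> F0; elim/big_ind : _ => //; first exact: (vle_refl HL).
by move=> x y x0 y0; apply: (vle_eq HL (vle_add HL x0 y0)); vlin.
Qed.

Lemma ex_max (P : nat -> nat -> Prop) n :
  (forall p N M, (N <= M)%N -> P p N -> P p M) -> (forall p, exists N, P p N) ->
  exists N, forall p, (p <= n)%N -> P p N.
Proof.
move=> Pm Pe; elim: n => [|n [N HN]].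
  by have [N PN] := Pe 0%N; exists N => p; rewrite leqn0 => /eqP ->.
have [M PM] := Pe n.+1; exists (maxn N M) => p; rewrite leq_eqVlt => /orP[/eqP ->|].
  exact: Pm (leq_maxr _ _) PM.
by rewrite ltnS => /HN; exact: Pm (leq_maxl _ _).
Qed.

(* The averages are near-minimisers on the tails of all the convex functionals
   [b |-> h_k |ev b y_j - t|], where [t] runs through a fine grid of the interval
   [-u_j, u_j].  Their midpoints being near-minimisers too, [grid_le] makes
   the averages Cauchy for every [h_k], hence in norm. *)
Lemma order_bounded_averages_cvg (y : nat -> nat -> X) (u : nat -> X) :
  (forall j n, ab le (y j n) <=| u j) ->
  exists c : nat -> dyavg nat, (forall N, dall (leq N) (c N)) /\
    forall j, exists l : X, (fun N => ev (c N) (y j)) @ \oo --> l.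
Proof.
move=> yu.
have u0 j : 0 <=| u j := vle_trans HL (ab_ge0 HL (y j 0%N)) (yu j 0%N).
have evu j b : ab le (ev b (y j)) <=| u j.
  apply: (vle_trans HL (ev_ab HL _ _)); rewrite -[X in _ <=| X](ev_const b).
  by apply: (ev_mono HL (P := fun=> True)) => //; exact: dallT.
(* The averages are shifted by [u j] into [0, 2 u j], and the grid points are halves of multiples of
   [st j q]. Sums of two shifted averages are compared with the multiples themselves, the last of
   which, for p = 2 (q + 1), is 4 u j. *)
pose st j q := (2 / q.+1%:R) *: u j.
pose f j p q k b := h k (ab le (ev b (y j) + u j - 2^-1 *: (p%:R *: st j q))).
pose psi i b := if unpickle i is Some (j, p, q, k) then f j p q k b else 0.
have fmid2 j p q k a b : 2 * f j p q k (Mid a b) <=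
    h k (ab le ((ev a (y j) + u j) + (ev b (y j) + u j) - p%:R *: st j q)).
  have h2 : (0 : R) <= 2^-1 by lra.
  rewrite /f; set z := (X in _ <= h k (ab le X)).
  have -> : ev (Mid a b) (y j) + u j - 2^-1 *: (p%:R *: st j q) = 2^-1 *: z.
    by rewrite /z /=; vlin.
  have := posfun_mono HL (hP k) (ab_scale HL 2^-1 z).
  by rewrite ger0_norm// (posfunZ (hP k))//; lra.
have fD j p q k a b :
    h k (ab le ((ev a (y j) + u j) + (ev b (y j) + u j) - p%:R *: st j q)) <=
    f j p q k a + f j p q k b.
  rewrite /f -(posfunD (hP k)); apply: (posfun_mono HL (hP k)).
  set z := (X in ab le X <=| _); have -> : z =
    (ev a (y j) + u j - 2^-1 *: (p%:R *: st j q)) +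
    (ev b (y j) + u j - 2^-1 *: (p%:R *: st j q)) by rewrite /z; vlin.
  exact: (ab_add HL).
have [i b|i|i a b|N|N M d NM|N a b|c [cN cdef]] := @near_minimizers R (dyavg nat)
   (@Mid nat) (fun N b => dall (leq N) b) psi.
- rewrite /psi; case: unpickle => [[[[j p] q] k]|//].
  exact: (posfun_ge0 HL (hP k) (ab_ge0 HL _)).
- rewrite /psi; case: unpickle => [[[[j p] q] k]|]; last by exists 0.
  exists (`|u j + u j - 2^-1 *: (p%:R *: st j q)| + `|u j + u j|) => b.
  apply: le_trans (posfun_le_norm HL (hP k) _) _; rewrite (norm_ab HL).
  have -> : ev b (y j) + u j - 2^-1 *: (p%:R *: st j q) =
    (u j + u j - 2^-1 *: (p%:R *: st j q)) - (u j - ev b (y j)) by vlin.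
  apply: le_trans (ler_normB _ _) _; rewrite lerD2l.
  apply: (norm_le_ab HL); apply: (ab_le HL).
    by apply: (vle_eq HL (vle_trans HL (ab_geN HL _) (evu j b))); vlin.
  rewrite opprB; apply: (vle_eq HL (vle_add HL (vle_trans HL (ab_ge HL _) (evu j b))
     (vle_add HL (u0 j) (u0 j)))); vlin.
- rewrite /psi; case: unpickle => [[[[j p] q] k]|]; last by rewrite mulr0 addr0.
  exact: le_trans (fmid2 _ _ _ _ _ _) (fD _ _ _ _ _ _).
- by exists (Pt N); rewrite /= leqnn.
- by apply: dall_imp => i; exact: leq_trans.
- by [].
exists c; split=> // j; apply: cauchy_seq_cvg => e e0.
have [K [d [d0 small]]] := order_bounded_small (u j + u j) e0.
have [q Hq] : exists q, (2 / q.+1%:R) * `|u j| <= d / 2.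
  have d'0 : 0 < d / (4 * (`|u j| + 1)).
    by rewrite divr_gt0// mulr_gt0// ltr_wpDl.
  have [q /(_ q (leqnn q)) Hq] := inv_nat_small d'0; exists q.
  have uj1 : 0 < `|u j| + 1 by rewrite ltr_wpDl.
  move: Hq; rewrite ler_pdivlMr ?mulr_gt0//.
  have : 0 <= q.+1%:R^-1 :> R by rewrite invr_ge0.
  by move: (q.+1%:R^-1) => t; lra.
pose n0 := (2 * q.+1)%N.
(* The n0 + 1 defects will contribute at most d/2, and the mesh of the grid another d/2. *)
pose eta := d / (2 * n0.+1%:R).
have eta0 : 0 < eta by rewrite divr_gt0// mulr_gt0.
have [N HN] : exists N, forall k, (k <= K)%N -> forall p, (p <= n0)%N ->
    forall n m, (N <= n)%N -> (N <= m)%N ->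
    f j p q k (c n) + f j p q k (c m) - 2 * f j p q k (Mid (c n) (c m)) <= eta.
  apply: ex_max => [k N M NM H p pn n m Mn Mm|k].
    by apply: H => //; exact: leq_trans NM _.
  apply: ex_max => [p N M NM H n m Mn Mm|p]; first by apply: H; exact: leq_trans NM _.
  have [N HN] := cdef (pickle (j, p, q, k)) eta eta0; exists N => n m Nn Nm.
  by have := HN n m Nn Nm; rewrite /psi pickleK.
exists N => n m Nn nm; have Nm := leq_trans Nn nm.
rewrite -(norm_ab HL); apply: small; first exact: (ab_ge0 HL).
  apply: (ab_le HL).
    apply: (vle_eq HL (vle_add HL (vle_trans HL (ab_ge HL _) (evu j (c m)))
      (vle_trans HL (ab_geN HL _) (evu j (c n))))); vlin.
  apply: (vle_eq HL (vle_add HL (vle_trans HL (ab_ge HL _) (evu j (c n)))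
      (vle_trans HL (ab_geN HL _) (evu j (c m))))); vlin.
move=> k kK.
pose x := ev (c m) (y j) + u j; pose z := ev (c n) (y j) + u j.
(* [D p] is the convexity defect at the grid point [p]. The vector |x - z| minus all the defects
   lies below every |x + z - p st|, so [grid_le] applies to it. *)
pose D p := ab le (x - 2^-1 *: (p%:R *: st j q)) + ab le (z - 2^-1 *: (p%:R *: st j q)) -
  ab le (x + z - p%:R *: st j q).
have D0 p : 0 <=| D p.
  have := ab_add HL (x - 2^-1 *: (p%:R *: st j q)) (z - 2^-1 *: (p%:R *: st j q)).
  have -> : x - 2^-1 *: (p%:R *: st j q) + (z - 2^-1 *: (p%:R *: st j q)) =
    x + z - p%:R *: st j q by vlin.
  by move=> H; apply: (vle_eq HL H); rewrite /D; vlin.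
have Dge p : ab le (x - z) <=| D p + ab le (x + z - p%:R *: st j q).
  rewrite /D subrK.
  have -> : x - z = (x - 2^-1 *: (p%:R *: st j q)) + - (z - 2^-1 *: (p%:R *: st j q)) by vlin.
  by apply: (vle_trans HL (ab_add HL _ _)); rewrite (abN HL); exact: (vle_refl HL).
have hD p : (p <= n0)%N -> h k (D p) <= eta.
  move=> pn; apply: le_trans (HN k kK p pn m n Nm Nn).
  rewrite /D (posfunB (hP k)) (posfunD (hP k)) -!/(f j p q k _).
  by have := fmid2 j p q k (c m) (c n); rewrite -/x -/z; lra.
have grid : ab le (x - z) - \sum_(p < n0.+1) D p <=|
    st j q + ps le (x + z - n0%:R *: st j q).
  apply: grid_le => [||i ni].
  - apply: (vle_eq HL (vle_add HL (vle_trans HL (ab_geN HL _) (evu j (c m)))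
      (vle_trans HL (ab_geN HL _) (evu j (c n))))); rewrite /x /z; vlin.
  - by have q0 : 0 <= 2 / q.+1%:R :> R by []; have := vle_scale HL q0 (u0 j); rewrite scaler0.
  have ni' : (i < n0.+1)%N by [].
  rewrite (bigD1 (Ordinal ni'))//=; set Sr := \sum_(_ < _ | _) _.
  have Sr0 : 0 <=| Sr by exact: vsum_ge0.
  apply: (vle_trans HL _ (vle_refl HL (ab le (x + z - i%:R *: st j q)))).
  by apply: (vle_eq HL (vle_add HL (Dge i) Sr0)); vlin.
have pz : ps le (x + z - n0%:R *: st j q) = 0.
  apply: (vle_anti HL); last exact: (ps_ge0 HL).
  apply: (ps_le HL); first exact: (vle_refl HL).
  have -> : n0%:R *: st j q = 4 *: u j.
    rewrite /st scalerA /n0 natrM; congr (_ *: _); field.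
    by rewrite addrC natr1 pnatr_eq0.
  apply: (vle_eq HL (vle_add HL (vle_trans HL (ab_ge HL _) (evu j (c m)))
      (vle_trans HL (ab_ge HL _) (evu j (c n))))); rewrite /x /z; vlin.
have -> : ev (c m) (y j) - ev (c n) (y j) = x - z by rewrite /x /z; vlin.
have := posfun_mono HL (hP k) grid; rewrite pz addr0 (posfunB (hP k)) (posfun_sum (hP k)).
have : \sum_(p < n0.+1) h k (D p) <= d / 2.
  apply: (@le_trans _ _ (\sum_(p < n0.+1) eta)).
    by apply: ler_sum => p _; apply: hD; exact: ltn_ord p.
  rewrite sumr_const card_ord -mulr_natr /eta.
  have n00 : (n0.+1%:R : R) != 0 by rewrite pnatr_eq0.
  rewrite le_eqVlt; apply/orP; left; apply/eqP; field.
  by rewrite -natr1 in n00.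
have : h k (st j q) <= d / 2.
  apply: le_trans (posfun_le_norm HL (hP k) _) _.
  by rewrite normrZ ger0_norm//; exact: Hq.
lra.
Qed.

End OrderBounded.

(** * The regular part of a bounded sequence *)

Section Truncation.
Variables (R : realType) (X : completeNormedModType R) (le : X -> X -> Prop).
Hypothesis HL : is_banach_lattice le.
Local Notation "x <=| y" := (le x y) (at level 70).
Implicit Types (u x y : X).

(* [trunc u x] is [x] truncated to the order interval [-u, u], and [excess u x]
   is the modulus of the part of [x] that is cut off. *)
Definition excess u x := ps le (x - u) + ps le (- x - u).
Definition trunc u x := x - ps le (x - u) + ps le (- x - u).

Lemma excess_ge0 u x : 0 <=| excess u x.
Proof.
by apply: (vle_eq HL (vle_add HL (ps_ge0 HL (x - u)) (ps_ge0 HL (- x - u)))); rewrite addr0.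
Qed.

Lemma ab_sub_trunc u x : ab le (x - trunc u x) <=| excess u x.
Proof.
rewrite /trunc /excess; apply: (ab_le HL).
  by apply: (vle_eq HL (vle_add HL (ps_ge0 HL (- x - u)) (ps_ge0 HL (- x - u)))); vlin.
by apply: (vle_eq HL (vle_add HL (ps_ge0 HL (x - u)) (ps_ge0 HL (x - u)))); vlin.
Qed.

Lemma truncN u x : trunc u (- x) = - trunc u x.
Proof. by rewrite /trunc opprK; vlin. Qed.

Lemma trunc_le u x : 0 <=| u -> trunc u x <=| u.
Proof.
move=> u0; have H : ps le (- x - u) <=| u - x + ps le (x - u).
  apply: (ps_le HL); first by apply: (vle_eq HL (ps_ge HL (x - u))); vlin.
  by apply: (vle_eq HL (vle_add HL (ps_ge0 HL (x - u)) (vle_add HL u0 u0))); vlin.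
by apply: (vle_eq HL H); rewrite /trunc; vlin.
Qed.

Lemma ab_trunc u x : 0 <=| u -> ab le (trunc u x) <=| u.
Proof.
move=> u0; apply: (ab_le HL); first exact: trunc_le.
by rewrite -truncN; exact: trunc_le.
Qed.

Lemma ps_sub u x : 0 <=| u -> ps le (x - u) <=| ps le x.
Proof. by move=> u0; apply: (ps_mono HL); apply: (vle_eq HL u0); vlin. Qed.

Lemma ps_sub_ge u x : 0 <=| u -> ps le x <=| ps le (x - u) + u.
Proof.
move=> u0; apply: (ps_le HL); last by apply: (vle_eq HL (ps_ge HL (x - u))); vlin.
by apply: (vle_eq HL (vle_add HL u0 (ps_ge0 HL (x - u)))); vlin.
Qed.

Lemma excess_le u x : 0 <=| u -> excess u x <=| ab le x.
Proof.
move=> u0; rewrite (ab_ps HL); apply: (vle_add HL); exact: ps_sub.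
Qed.

Lemma ab_excess_le u x : 0 <=| u -> ab le x - excess u x <=| u + u.
Proof.
move=> u0; rewrite (ab_ps HL) /excess.
by apply: (vle_eq HL (vle_add HL (ps_sub_ge x u0) (ps_sub_ge (- x) u0))); vlin.
Qed.

Lemma excess_mono u v x : u <=| v -> excess v x <=| excess u x.
Proof.
move=> uv; apply: (vle_add HL); apply: (ps_mono HL); apply: (vle_eq HL uv); vlin.
Qed.

Lemma trunc_diff u v x : u <=| v -> trunc v x - trunc u x <=| excess u x - excess v x.
Proof.
move=> uv; have H : ps le (- x - v) <=| ps le (- x - u).
  by apply: (ps_mono HL); apply: (vle_eq HL uv); vlin.
by rewrite /trunc /excess; apply: (vle_eq HL (vle_add HL H H)); vlin.
Qed.

Lemma excessN u x : excess u (- x) = excess u x.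
Proof. by rewrite /excess opprK addrC. Qed.

Lemma trunc_dist1 u x y : ab le y <=| u -> trunc u x - y <=| ab le (x - y) - excess u x.
Proof.
move=> yu; rewrite (ab_ps HL) -[in ps le (x - y)](opprK (x - y)) (psN HL (- (x - y))).
have H : ps le (- x - u) <=| ps le (- (x - y)).
  apply: (ps_mono HL); apply: (vle_eq HL (vle_trans HL (ab_geN HL y) yu)); vlin.
by rewrite /trunc /excess; apply: (vle_eq HL (vle_add HL H H)); vlin.
Qed.

(** Truncation splits the distance from [x] to a point [y] of [-u, u] into the distance of the
    truncation and the excess; for real numbers this is an equality. It is the source of the
    disjointness of singular parts from [X]. *)
Lemma trunc_dist u x y : ab le y <=| u ->
  ab le (trunc u x - y) + excess u x <=| ab le (x - y).
Proof.
move=> yu; suff H : ab le (trunc u x - y) <=| ab le (x - y) - excess u x.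
  by apply: (vle_eq HL H); vlin.
apply: (ab_le HL); first exact: trunc_dist1.
have yuN : ab le (- y) <=| u by rewrite (abN HL).
have := trunc_dist1 (- x) yuN; rewrite excessN truncN -!opprD (abN HL) .
by [].
Qed.

(** [trunc_dist] applied to the truncation of [y], which costs the excess of [y] twice. *)
Lemma trunc_dist_gen u x y : 0 <=| u ->
  ab le (trunc u x - y) + excess u x <=| ab le (x - y) + (excess u y + excess u y).
Proof.
move=> u0; have H1 := trunc_dist x (ab_trunc y u0).
have H2 := ab_tri HL (x - trunc u y) (x - y).
have H3 := ab_tri HL (trunc u x - y) (trunc u x - trunc u y).
have E2 : x - trunc u y - (x - y) = y - trunc u y by vlin.
have E3 : trunc u x - y - (trunc u x - trunc u y) = - (y - trunc u y) by vlin.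
rewrite E2 in H2; rewrite E3 (abN HL) in H3.
have H4 := ab_sub_trunc u y.
by apply: (vle_eq HL (vle_add HL (vle_add HL H1 H2) (vle_add HL H3 (vle_add HL H4 H4)))); vlin.
Qed.

(** With [d] taken in a dense sequence, this makes the excess of any fixed [x] small once [u] is
    large. *)
Lemma excess_le_dist u x d : ab le d <=| u -> excess u x <=| ab le (x - d) + ab le (x - d).
Proof.
move=> du; apply: (vle_add HL); apply: (ps_le HL (ab_ge0 HL _)).
  apply: (vle_trans HL _ (ab_ge HL _)).
  by apply: (vle_eq HL (vle_trans HL (ab_ge HL d) du)); vlin.
apply: (vle_trans HL _ (ab_geN HL _)).
by apply: (vle_eq HL (vle_trans HL (ab_geN HL d) du)); vlin.
Qed.

End Truncation.

Lemma dall_eventually (T : Type) (Q : T -> nat -> Prop) (b : dyavg T) :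
  (forall y, exists L0, forall L, (L0 <= L)%N -> Q y L) ->
  exists L0, forall L, (L0 <= L)%N -> dall (Q ^~ L) b.
Proof.
move=> H; elim: b => [y|a [La IHa] c [Lc IHc]]; first exact: H.
by exists (maxn La Lc) => L; rewrite geq_max => /andP[/IHa ? /IHc].
Qed.

Section RegularPart.
Variables (R : realType) (X : completeNormedModType R) (le : X -> X -> Prop).
Hypothesis HL : is_banach_lattice le.
Local Notation "x <=| y" := (le x y) (at level 70).
Hypothesis KB : kb_lattice le.
Hypothesis sepX : separable X.

Lemma vle_lim2 (s t : nat -> X) (l m : X) : s @ \oo --> l -> t @ \oo --> m ->
  (forall n, s n <=| t n) -> l <=| m.
Proof.
move=> sl tm st; apply: (vle_ge0 HL).
apply: (vle_lim HL (s := fun n => t n - s n) (N := 0%N)); first exact: cvgB.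
by move=> n _; apply: (vle_eq HL (st n)); vlin.
Qed.

(* [z] plays the role of the projection onto the band [X] of a weak-star
   cluster point of [x] in the bidual of [X], and [W] that of the modulus of the
   complementary singular part, which is disjoint from everything in [X]. *)
Lemma regular_part (x : nat -> X) (M : R) : (forall n, `|x n| <= M) ->
  exists z : X, `|z| <= M /\ forall N (Y : dyavg X) (e : R), 0 < e -> exists b W,
    [/\ dall (leq N) b, 0 <=| W, pn le (ab le (ev b x - z) - W) <= e &
      dall (fun y => pn le (ab le (z - y) + W - ev b (fun i => ab le (x i - y))) <= e) Y].
Proof.
move=> xM; have [h [hP hsep]] := separating_posfuns HL sepX.
have [d dP] := separableP sepX.
(* The intervals [-U L, U L] increase and together contain a dense sequence. *)
pose U L := \sum_(0 <= i < L) ab le (d i).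
have U0 L : 0 <=| U L by apply: (vsum_ge0 HL) => i _; exact: (ab_ge0 HL).
have US L : U L <=| U L.+1.
  rewrite /U big_nat_recr//=; apply: (vle_eq HL (ab_ge0 HL (d L))).
  by rewrite addrAC subrr add0r subr0.
have Umono := vle_homo HL US.
have dU i L : (i < L)%N -> ab le (d i) <=| U L.
  move=> iL; apply: (vle_trans HL _ (Umono _ _ iL)); rewrite /U big_nat_recr//=.
  by apply: (vle_eq HL (U0 i)); rewrite subr0 addrK.
pose tm u y := ab le y - excess le u y.
(* Truncations and truncated moduli are interleaved, so that a single sequence of averages makes
   both converge at all levels [L]. *)
pose yy j n := if odd j then tm (U j./2) (x n) else trunc le (U j./2) (x n).
have yb j n : ab le (yy j n) <=| U j./2 + U j./2.
  rewrite /yy; case: odd.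
    rewrite /tm (ab_id HL); first exact: (ab_excess_le HL).
    by apply: (vle_eq HL (excess_le HL (x n) (U0 j./2))); rewrite subr0.
  apply: (vle_trans HL (ab_trunc HL _ (U0 _))).
  by apply: (vle_eq HL (U0 j./2)); rewrite subr0 addrK.
have [c [cN ccvg]] := order_bounded_averages_cvg HL KB hP hsep yb.
have zex L : exists l : X, (fun N => ev (c N) (fun i => trunc le (U L) (x i))) @ \oo --> l.
  by have := ccvg L.*2; rewrite /yy odd_double doubleK.
have tex L : exists l : X, (fun N => ev (c N) (fun i => tm (U L) (x i))) @ \oo --> l.
  by have := ccvg L.*2.+1; rewrite /yy /= odd_double /= uphalf_double.
pose zL L := sval (cid (zex L)); pose tL L := sval (cid (tex L)).
have zLP L : (fun N => ev (c N) (fun i => trunc le (U L) (x i))) @ \oo --> zL L.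
  by rewrite /zL; case: cid.
have tLP L : (fun N => ev (c N) (fun i => tm (U L) (x i))) @ \oo --> tL L.
  by rewrite /tL; case: cid.
have evle (b : dyavg nat) (F G : nat -> X) : (forall i, F i <=| G i) -> ev b F <=| ev b G.
  by move=> FG; apply: (ev_mono HL (P := fun=> True)) => //; exact: dallT.
have tm0 u y : 0 <=| u -> 0 <=| tm u y.
  by move=> u0; apply: (vle_eq HL (excess_le HL y u0)); rewrite subr0.
have tmono L : tL L <=| tL L.+1.
  apply: (vle_lim2 (tLP L) (tLP L.+1)) => n; apply: evle => i.
  by rewrite /tm; apply: (vle_eq HL (excess_mono HL (x i) (US L))); vlin.
have tbd L : `|tL L| <= M.
  apply: (lim_norm_le (tLP L)) => n; apply: (norm_ev (P := fun=> True)); first exact: dallT.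
  move=> i _; apply: le_trans (xM i); rewrite -(norm_ab HL (x i)); apply: (norm_le HL).
    exact: tm0.
  by apply: (vle_eq HL (excess_ge0 HL (U L) (x i))); rewrite /tm; vlin.
have [t tP] : exists t : X, tL @ \oo --> t by apply: KB => //; exists M.
(* The vectors [tL], which converge by [KB], control the increments of [zL], which is therefore
   Cauchy. *)
have zt L L' : (L <= L')%N -> ab le (zL L' - zL L) <=| tL L' - tL L.
  move=> LL'.
  have cz : (fun N => ev (c N) (fun i => trunc le (U L') (x i)) -
      ev (c N) (fun i => trunc le (U L) (x i))) @ \oo --> zL L' - zL L by exact: cvgB.
  have ct : (fun N => ev (c N) (fun i => tm (U L') (x i)) -
      ev (c N) (fun i => tm (U L) (x i))) @ \oo --> tL L' - tL L by exact: cvgB.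
  have czN : (fun N => - (ev (c N) (fun i => trunc le (U L') (x i)) -
      ev (c N) (fun i => trunc le (U L) (x i)))) @ \oo --> - (zL L' - zL L) by exact: cvgN.
  apply: (ab_le HL).
    apply: (vle_lim2 cz ct) => n /=; rewrite -!evB; apply: evle => i /=.
    apply: (vle_trans HL (trunc_diff HL (x i) (Umono _ _ LL'))).
    by rewrite /tm; apply: (vle_eq HL (vle_refl HL 0)); vlin.
  apply: (vle_lim2 czN ct) => n /=; rewrite -!evB -evN; apply: evle => i /=.
  have := trunc_diff HL (- x i) (Umono _ _ LL'); rewrite !truncN !excessN => H.
  by rewrite /tm; apply: (vle_eq HL H); vlin.
have [z zP] : exists z : X, zL @ \oo --> z.
  apply: cauchy_seq_cvg => e e0; have [N HN] := cauchy_of_cvg tP e0.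
  exists N => n m Nn nm; apply: le_trans (HN n m Nn (leq_trans Nn nm)).
  exact: (norm_le_ab HL (zt _ _ nm)).
have main (N : nat) (Y : dyavg X) (e : R) : 0 < e -> exists b W,
    [/\ dall (leq N) b, 0 <=| W, pn le (ab le (ev b x - z) - W) <= e &
      dall (fun y => pn le (ab le (z - y) + W - ev b (fun i => ab le (x i - y))) <= e) Y].
  move=> e0; have e40 : 0 < e / 4 by lra.
  have [L1 HL1] : exists L0, forall L, (L0 <= L)%N -> dall (fun y => `|excess le (U L) y| <= e / 4) Y.
    apply: dall_eventually => y; have e80 : 0 < e / 8 by lra.
    have [i Hi] := dP y _ e80; exists i.+1 => L iL.
    apply: le_trans (norm_le HL (excess_ge0 HL _ _) (excess_le_dist HL y (dU _ _ iL))) _.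
    by apply: le_trans (ler_normD _ _) _; rewrite (norm_ab HL) distrC; lra.
  have /cvg_seqP/(_ _ e40)[L2 HL2] := zP.
  pose L := maxn L1 L2.
  have /cvg_seqP/(_ _ e40)[n1 Hn1] := zLP L.
  (* [W] is the average excess over the level [L], a stand-in for the modulus of the singular
     part. *)
  pose n := maxn N n1; pose b := c n; pose W := ev b (fun i => excess le (U L) (x i)).
  have A1 : `|ev b (fun i => trunc le (U L) (x i)) - zL L| <= e / 4.
    by apply: Hn1; exact: leq_maxr.
  have A2 : `|zL L - z| <= e / 4 by apply: HL2; exact: leq_maxr.
  set tr := ev b (fun i => trunc le (U L) (x i)) in A1.
  exists b, W; split.
  - by apply: dall_imp (cN n) => i; apply: leq_trans; exact: leq_maxl.
  - by apply: (ev_ge0 HL) => i; exact: (excess_ge0 HL).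
  - apply: (@le_trans _ _ (pn le (ab le (tr - zL L) + ab le (zL L - z)))).
      apply: (pn_mono HL).
      have H1 := ab_add HL (tr - zL L) (zL L - z).
      have H2 := ab_add HL (ev b (fun i => x i - trunc le (U L) (x i))) (tr - zL L + (zL L - z)).
      have E : ev b (fun i => x i - trunc le (U L) (x i)) + (tr - zL L + (zL L - z)) = ev b x - z.
        by rewrite evB -/tr; vlin.
      rewrite E in H2.
      have H3 := ev_ab HL b (fun i => x i - trunc le (U L) (x i)).
      have H4 : ev b (fun i => ab le (x i - trunc le (U L) (x i))) <=| W.
        by apply: evle => i; exact: (ab_sub_trunc HL).
      by apply: (vle_eq HL (vle_add HL (vle_add HL H1 H2) (vle_add HL H3 H4))); vlin.
    apply: le_trans (pn_le_norm HL _) _; apply: le_trans (ler_normD _ _) _.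
    by rewrite !(norm_ab HL); lra.
  - apply: dall_imp (HL1 L (leq_maxl _ _)) => y Hy.
    apply: (@le_trans _ _ (pn le (ab le (tr - zL L) + ab le (zL L - z) +
        (excess le (U L) y + excess le (U L) y)))).
      apply: (pn_mono HL).
      have H1 := ab_tri HL (z - y) (tr - y).
      have H2 := ab_add HL (tr - zL L) (zL L - z).
      have E1 : z - y - (tr - y) = - (tr - z) by vlin.
      have E2 : tr - zL L + (zL L - z) = tr - z by vlin.
      rewrite E1 (abN HL) in H1; rewrite E2 in H2.
      have H3 := ev_ab HL b (fun i => trunc le (U L) (x i) - y).
      rewrite evB ev_const -/tr in H3.
      have H4 : ev b (fun i => ab le (trunc le (U L) (x i) - y) + excess le (U L) (x i)) <=|
          ev b (fun i => ab le (x i - y) + (excess le (U L) y + excess le (U L) y)).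
        by apply: evle => i; exact: (trunc_dist_gen HL).
      rewrite (evD _ _ (fun i => excess le (U L) (x i))) in H4.
      rewrite (evD _ _ (fun=> excess le (U L) y + excess le (U L) y)) ev_const -/W in H4.
      by apply: (vle_eq HL (vle_add HL (vle_add HL H1 H2) (vle_add HL H3 H4))); vlin.
    apply: le_trans (pn_le_norm HL _) _; apply: le_trans (ler_normD _ _) _.
    have := ler_normD (ab le (tr - zL L)) (ab le (zL L - z)).
    have := ler_normD (excess le (U L) y) (excess le (U L) y).
    by rewrite !(norm_ab HL); lra.
exists z; split; last exact: main.
(* Testing against y = 0 bounds |z| + W by the average of the |x i|, up to [e]. *)
apply/ler_addgt0Pr => e e0; have [b [W [_ W0 _ /=]]] := main 0%N (Pt 0) e e0.
rewrite subr0 => H; rewrite -(norm_ab HL) -(pn_id HL (ab_ge0 HL z)).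
have Hev : pn le (ev b (fun i => ab le (x i - 0))) <= M.
  apply: le_trans (pn_le_norm HL _) _; apply: (norm_ev (P := fun=> True)); first exact: dallT.
  by move=> i _; rewrite subr0 (norm_ab HL).
have := pn_add HL (ab le z + W - ev b (fun i => ab le (x i - 0))) (ev b (fun i => ab le (x i - 0))).
have : pn le (ab le z) <= pn le (ab le z + W - ev b (fun i => ab le (x i - 0)) +
  ev b (fun i => ab le (x i - 0))).
  by apply: (pn_mono HL); apply: (vle_eq HL W0); vlin.
lra.
Qed.

End RegularPart.

(** * Concentration of interlacing maps *)

(* [itl l n T] means [l_1 <= n_1 < l_2 <= n_2 < ... < T]. *)
Inductive itl : seq nat -> seq nat -> nat -> Prop :=
| itl_nil T : itl [::] [::] T
| itl_rcons l n T a b T' : itl l n T -> (T <= a)%N -> (a <= b)%N -> (b < T')%N ->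
    itl (rcons l a) (rcons n b) T'.

Lemma itl_size l n T : itl l n T -> size l = size n.
Proof. by elim=> // {}l {}n {}T a b T' _ IH *; rewrite !size_rcons IH. Qed.

Lemma itl_sorted l n T : itl l n T ->
  [/\ sorted ltn l, sorted ltn n, all (ltn^~ T) l & all (ltn^~ T) n].
Proof.
elim=> // {}l {}n {}T a b T' _ [sl sn lT nT] Ta ab bT.
have lt_all s c : (T <= c)%N -> all (ltn^~ T) s -> all (ltn^~ c) s.
  by move=> Tc; apply: sub_all => i /= /leq_trans; exact.
have sorted_rc s c : (T <= c)%N -> sorted ltn s -> all (ltn^~ T) s -> sorted ltn (rcons s c).
  move=> Tc; rewrite !(sorted_pairwise ltn_trans) pairwise_rcons => -> /(lt_all _ _ Tc).
  by rewrite andbT.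
split; [exact: sorted_rc|exact: sorted_rc _ _ (leq_trans Ta ab) _ _| |].
  rewrite all_rcons; apply/andP; split; first exact: leq_ltn_trans ab bT.
  by apply: lt_all lT; lia.
by rewrite all_rcons; apply/andP; split=> //; apply: lt_all nT; lia.
Qed.

Lemma dall_ex (T : Type) (P : T -> Prop) (b : dyavg T) : dall P b -> exists i, P i.
Proof. by elim: b => [i|a IHa c _ [/IHa]]//=; exists i. Qed.

Lemma dall_bound (b : dyavg nat) : exists T0, forall T, (T0 <= T)%N -> dall (fun a => (a < T)%N) b.
Proof. by apply: dall_eventually => a; exists a.+1. Qed.

Lemma ev_map (R : realType) (V : lmodType R) (T U : Type) (g : T -> U) (b : dyavg T) (y : U -> V) :
  ev (dmap g b) y = ev b (fun i => y (g i)).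
Proof. exact: ev_bind. Qed.

Lemma dall_map (T U : Type) (g : T -> U) (b : dyavg T) (P : U -> Prop) :
  dall P (dmap g b) <-> dall (fun i => P (g i)) b.
Proof. exact: dall_bind. Qed.

Section Concentration.
Variables (R : realType) (X : completeNormedModType R) (le : X -> X -> Prop).
Hypothesis HL : is_banach_lattice le.
Local Notation "x <=| y" := (le x y) (at level 70).
Hypothesis KB : kb_lattice le.
Hypothesis sepX : separable X.

(** [W] dominates the singular part of the average of [x]; the last inequality says that this part
    adds up with the distance from [z] to each test point. *)
Definition regular_limit (x : nat -> X) (z : X) :=
  forall (N : nat) (Y : dyavg X) (e : R), 0 < e -> exists b W,
    [/\ dall (leq N) b, 0 <=| W, pn le (ab le (ev b x - z) - W) <= e &
      dall (fun y => pn le (ab le (z - y) + W - ev b (fun i => ab le (x i - y))) <= e) Y].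

(** [G d] is the iterated limit in the last [d] variables; the bound [M] is carried along because
    [regular_part] asks for it at each stage. *)
Lemma iterated_regular_limits (f : seq nat -> X) (M : R) : (forall s, `|f s| <= M) ->
  exists G : nat -> seq nat -> X, G 0%N = f /\
    forall d s, regular_limit (fun n => G d (rcons s n)) (G d.+1 s).
Proof.
move=> fM; pose T := {g : seq nat -> X | forall s, `|g s| <= M}.
have step (g : T) : exists g' : T, forall s, regular_limit (fun n => sval g (rcons s n)) (sval g' s).
  have ex s := regular_part HL KB sepX (fun n => svalP g (rcons s n)).
  have bd s : `|sval (cid (ex s))| <= M by case: cid => z [].
  by exists (exist _ (fun s => sval (cid (ex s))) bd) => s /=; case: cid => z [].
pose G d := sval (iter d (fun g => sval (cid (step g))) (exist _ f fM : T)).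
by exists G; split=> // d s; rewrite /G /=; case: cid.
Qed.

(* After [j] steps, [m] is one [j]-tuple, [A] and [B] are averages of [j]-tuples [l]
   and [n] with [m], [n] and [l], [n] interlacing, and [V] dominates the singular
   parts accumulated by [B].  The second inequality is what keeps [V] bounded. *)
Definition tree_state (g : seq nat -> X) (x : X) (T0 j : nat) (e : R) :=
  exists (m : seq nat) (A B : dyavg (seq nat)) (V : X) (T : nat),
  [/\ size m = j, all (leq T0) m /\ (T0 <= T)%N,
    dall (fun n => itl m n T /\ dall (fun l => itl l n T) A) B,
    pn le (ab le (ev B g - x) - V) <= e &
    pn le (V - ev B (fun n => ev A (fun l => ab le (g n - g l)))) <= e].

(** Extend [m] by [T], then the [l] by averages starting at [T] and tested against the [g n], then
    the [n] by averages past all of these and tested against the new [l]. Up to [eta], the first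
    averaging does not decrease |g n - g l| and the second adds [Wn n] to it, so [V + ev B Wn] is
    again below the average distance. *)
Lemma tree_step (g g' : seq nat -> X) x T0 j (e eta : R) :
  (forall s, regular_limit (fun n => g' (rcons s n)) (g s)) -> 0 < eta ->
  tree_state g x T0 j e -> tree_state g' x T0 j.+1 (e + eta + eta).
Proof.
move=> reg eta0 [m [A [B [V [T [sm [mT0 T0T] itAB Hx HV]]]]]].
have exl l := reg l T (dmap g B) eta eta0.
pose bl l := sval (cid (exl l)).
have blP l : dall (leq T) (bl l) /\ dall (fun n => pn le (ab le (g n - g l) -
    ev (bl l) (fun a => ab le (g n - g' (rcons l a)))) <= eta) B.
  rewrite /bl; case: cid => b [W [bT W0 _ /dall_map bY]] /=; split=> //.
  (* The singular term of this first extension is dropped, being positive. *)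
  apply: dall_imp bY => n; apply: le_trans; apply: (pn_mono HL).
  rewrite (abB HL (g n)); apply: (vle_eq HL W0).
  have -> : (fun a => ab le (g n - g' (rcons l a))) = (fun a => ab le (g' (rcons l a) - g n)).
    by apply/funext => a; rewrite (abB HL).
  vlin.
pose A' := dbind A (fun l => dmap (rcons l) (bl l)).
have [T1 [TT1 AT1]] : exists T1, (T <= T1)%N /\
    dall (fun l => dall (fun a => (a < T1)%N) (bl l)) A.
  have [T1 HT1] := @dall_eventually _ (fun l T => dall (fun a => (a < T)%N) (bl l)) A
    (fun l => dall_bound (bl l)).
  by exists (maxn T T1); rewrite leq_maxl; split=> //; apply: HT1; exact: leq_maxr.
have exn n := reg n T1 (dmap g' A') eta eta0.
pose bn n := sval (cid (exn n)).
have exW n : exists W, [/\ dall (leq T1) (bn n),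
    pn le (ab le (ev (bn n) (fun b => g' (rcons n b)) - g n) - W) <= eta &
    dall (fun l => pn le (ab le (g n - g' l) + W -
      ev (bn n) (fun b => ab le (g' (rcons n b) - g' l))) <= eta) A'].
  by have [W [H1 _ H2 /dall_map H3]] := svalP (cid (exn n)); exists W.
pose Wn n := sval (cid (exW n)).
have WnP n : [/\ dall (leq T1) (bn n),
    pn le (ab le (ev (bn n) (fun b => g' (rcons n b)) - g n) - Wn n) <= eta &
    dall (fun l => pn le (ab le (g n - g' l) + Wn n -
      ev (bn n) (fun b => ab le (g' (rcons n b) - g' l))) <= eta) A'].
  by rewrite /Wn; case: cid.
pose B' := dbind B (fun n => dmap (rcons n) (bn n)).
have [T2 [T1T2 BT2]] : exists T2, (T1 <= T2)%N /\
    dall (fun n => dall (fun b => (b < T2)%N) (bn n)) B.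
  have [T2 HT2] := @dall_eventually _ (fun n T => dall (fun b => (b < T)%N) (bn n)) B
    (fun n => dall_bound (bn n)).
  by exists (maxn T1 T2); rewrite leq_maxl; split=> //; apply: HT2; exact: leq_maxr.
exists (rcons m T), A', B', (V + ev B Wn), T2; split.
- by rewrite size_rcons sm.
- by rewrite all_rcons T0T; split=> //; lia.
- apply/dall_bind; apply: dall_imp (dall_and itAB BT2) => n [[mn ln] bT2].
  have [bT1 _ _] := WnP n.
  apply/dall_map; apply: dall_imp (dall_and bT1 bT2) => b [T1b bT].
  split; first by apply: itl_rcons mn _ _ bT => //; exact: leq_trans TT1 T1b.
  apply/dall_bind; apply: dall_imp (dall_and ln AT1) => l [il aT1].
  have [Ta _] := blP l.
  apply/dall_map; apply: dall_imp (dall_and Ta aT1) => a [Ta' aT].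
  by apply: itl_rcons il Ta' _ bT; lia.
- rewrite ev_bind.
  have -> : (fun n => ev (dmap (rcons n) (bn n)) g') =
    (fun n => ev (bn n) (fun b => g' (rcons n b))) by apply/funext => n; rewrite ev_map.
  set h := (fun n => ev (bn n) (fun b => g' (rcons n b))).
  pose Q n := ab le (h n - g n).
  apply: (@le_trans _ _ (pn le ((ab le (ev B g - x) - V) + ev B (fun n => Q n - Wn n)))).
    apply: (pn_mono HL); rewrite evB.
    have H1 := ab_add HL (ev B h - ev B g) (ev B g - x).
    have E1 : ev B h - ev B g + (ev B g - x) = ev B h - x by vlin.
    have H2 : ab le (ev B h - ev B g) <=| ev B Q by rewrite -evB; exact: (ev_ab HL).
    by rewrite E1 in H1; apply: (vle_eq HL (vle_add HL H1 H2)); vlin.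
  apply: le_trans (pn_add HL _ _) _; rewrite -[X in _ <= X]addrA; apply: lerD => //.
  apply: (@le_trans _ _ eta); last by rewrite lerDl ltW.
  apply: (pn_ev HL (P := fun=> True)); first exact: dallT.
  by move=> n _; have [_ + _] := WnP n.
- pose D n l := ab le (g n - g' l).
  pose E n := ev A' (fun l => D n l + Wn n - ev (bn n) (fun b => ab le (g' (rcons n b) - g' l))).
  pose F n := ev A (fun l => ab le (g n - g l) - ev (bl l) (fun a => ab le (g n - g' (rcons l a)))).
  (* The new error is the old one plus those of the two extensions. *)
  have EE : V + ev B Wn - ev B' (fun n => ev A' (fun l => ab le (g' n - g' l))) =
      (V - ev B (fun n => ev A (fun l => ab le (g n - g l)))) + ev B E + ev B F.
    rewrite /B' ev_bind.
    have -> : (fun n => ev (dmap (rcons n) (bn n)) (fun n => ev A' (fun l => ab le (g' n - g' l)))) =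
        (fun n => ev A (fun l => ab le (g n - g l)) - F n + Wn n - E n).
      apply/funext => n; rewrite ev_map ev_exch /E evB evD ev_const /F.
      have -> : ev A' (D n) = ev A (fun l => ev (bl l) (fun a => ab le (g n - g' (rcons l a)))).
        rewrite /A' ev_bind; congr (ev A _); apply/funext => l.
        by rewrite ev_map.
      by rewrite (evB A); vlin.
    rewrite (evB B _ E) (evD B _ Wn) (evB B _ F); vlin.
  rewrite EE; apply: le_trans (pn_add HL _ _) _; apply: lerD.
    apply: le_trans (pn_add HL _ _) _; apply: lerD => //.
    apply: (pn_ev HL (P := fun=> True)); first exact: dallT.
    move=> n _; have [_ _ H] := WnP n.
    by apply: (pn_ev HL H).
  have HF : dall (fun n => dall (fun l => pn le (ab le (g n - g l) -
      ev (bl l) (fun a => ab le (g n - g' (rcons l a)))) <= eta) A) B.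
    by apply: dall_exch; apply: (@dallT _ _ A) => l; case: (blP l).
  by apply: (pn_ev HL HF) => n Hn; apply: (pn_ev HL Hn).
Qed.

(** Split [f m - x] at the average of [f] over [B]. Interlacing bounds the first part by [w]; the
    second is below [V] up to 1, and [V] is below an average of the |f n - f l| up to 1, whence w +
    2. *)
Lemma concentration (f : seq nat -> X) (M w : R) (k : nat) : (forall s, `|f s| <= M) ->
  (forall l n T, itl l n T -> size l = k -> `|f l - f n| <= w) ->
  exists x, forall T0, exists m,
    [/\ size m = k, sorted ltn m, all (leq T0) m & `|f m - x| <= 2 * w + 2].
Proof.
move=> fM fw; have [G [G0 GS]] := iterated_regular_limits fM.
exists (G k [::]) => T0.
(* Each of the [k] steps costs [2 * eta], in total at most 1. *)
have eta0 : 0 < (2 * k.+1)%:R^-1 :> R by rewrite invr_gt0.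
set eta : R := _^-1 in eta0.
have tree j : (j <= k)%N -> tree_state (G (k - j)%N) (G k [::]) T0 j (j%:R * (2 * eta)).
  elim: j => [_|j IH jk].
    exists [::], (Pt [::]), (Pt [::]), 0, T0; rewrite subn0 mul0r.
    have z0 : pn le (0 : X) <= 0 by rewrite (pn_le0 HL)//; exact: (vle_refl HL).
    split=> //=; rewrite ?subrr ?(ab0 HL) ?subrr//.
    by split; [exact: itl_nil|exact: itl_nil].
  have := IH (ltnW jk); have -> : (k - j = (k - j.+1).+1)%N by lia.
  move=> /(tree_step (GS (k - j.+1)%N) eta0).
  by have -> : j%:R * (2 * eta) + eta + eta = j.+1%:R * (2 * eta) by rewrite -natr1; ring.
have := tree k (leqnn k); rewrite subnn G0 => -[m [A [B [V [T [sm [mT0 _] itAB Hx HV]]]]]].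
have e1 : k%:R * (2 * eta) <= 1.
  rewrite /eta natrM invfM mulVKf ?pnatr_eq0//.
  by rewrite ler_pdivrMr// mul1r ler_nat.
exists m; split=> //.
  by have [n [/itl_sorted[]]] := dall_ex itAB.
have H1 : pn le (ev B (fun n => ab le (f m - f n))) <= w.
  apply: (pn_ev HL itAB) => n [mn _]; apply: le_trans (pn_le_norm HL _) _.
  by rewrite (norm_ab HL); exact: fw mn sm.
have H2 : pn le (ev B (fun n => ev A (fun l => ab le (f n - f l)))) <= w.
  apply: (pn_ev HL itAB) => n [mn ln]; apply: (pn_ev HL ln) => l il.
  apply: le_trans (pn_le_norm HL _) _; rewrite (norm_ab HL) distrC.
  by apply: (fw _ _ _ il); rewrite (itl_size il) -(itl_size mn).
rewrite -(norm_ab HL) -(pn_id HL (ab_ge0 HL _)).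
set S2 := ev B (fun n => ev A _) in HV H2; set S1 := ev B _ in H1.
have : pn le (ab le (f m - G k [::])) <= pn le (S1 + ((ab le (ev B f - G k [::]) - V) + ((V - S2) + S2))).
  apply: (pn_mono HL).
  have K1 := ab_add HL (ev B (fun n => f m - f n)) (ev B f - G k [::]).
  rewrite evB ev_const in K1.
  have E1 : f m - ev B f + (ev B f - G k [::]) = f m - G k [::] by vlin.
  have K2 := ev_ab HL B (fun n => f m - f n).
  rewrite evB ev_const in K2; rewrite E1 in K1.
  by rewrite /S1; apply: (vle_eq HL (vle_add HL K1 K2)); vlin.
have := pn_add HL S1 ((ab le (ev B f - G k [::]) - V) + ((V - S2) + S2)).
have := pn_add HL (ab le (ev B f - G k [::]) - V) ((V - S2) + S2).
have := pn_add HL (V - S2) S2.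
lra.
Qed.

End Concentration.

(** * The interlacing metric *)

Section Ksub.
Variable k : nat.
Implicit Types A B C : ksub k.

Lemma ksub_size A : size (sval A) = k.
Proof. by case: A => s /= /andP[/eqP]. Qed.

Lemma ksub_sorted A : sorted ltn (sval A).
Proof. by case: A => s /= /andP[]. Qed.

Lemma ksub_elt_lt A i j : (i < j)%N -> (j < k)%N -> (ksub_elt A i < ksub_elt A j)%N.
Proof.
move=> ij jk; apply: (sorted_ltn_nth ltn_trans) => //; first exact: ksub_sorted.
  by rewrite inE ksub_size (ltn_trans ij).
by rewrite inE ksub_size.
Qed.

Lemma ksub_elt_le A i j : (i <= j)%N -> (j < k)%N -> (ksub_elt A i <= ksub_elt A j)%N.
Proof. by rewrite leq_eqVlt => /orP[/eqP ->//|ij jk]; exact/ltnW/ksub_elt_lt. Qed.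

Lemma ksub_ext A B : (forall i, (i < k)%N -> ksub_elt A i = ksub_elt B i) -> A = B.
Proof.
move=> H; apply: val_inj => /=; apply: (@eq_from_nth _ 0%N); rewrite ?ksub_size//.
Qed.

Lemma ksub_of_fun (g : nat -> nat) : (forall i, (i.+1 < k)%N -> (g i < g i.+1)%N) ->
  exists A, forall i, (i < k)%N -> ksub_elt A i = g i.
Proof.
move=> H; have P : (size (mkseq g k) == k) && sorted ltn (mkseq g k).
  rewrite size_mkseq eqxx /=; apply/(sortedP 0%N) => i; rewrite size_mkseq => ik.
  by rewrite !nth_mkseq ?(ltnW ik)//; exact: H.
by exists (exist (fun s => (size s == k) && sorted ltn s) _ P) => i ik; rewrite /ksub_elt /= nth_mkseq.
Qed.

Lemma interl_adj_sym A B : interl_adj A B -> interl_adj B A.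
Proof. by move=> [AB H]; split; [move=> E; apply: AB|case: H; [right|left]]. Qed.

Lemma walk_cat n m A B C :
  walk (@interl_adj k) n A B -> walk (@interl_adj k) m B C -> walk (@interl_adj k) (n + m) A C.
Proof.
elim: n A => [A /= ->//|n IH A /= [D [AD DB]] BC]; exists D; split=> //; exact: IH.
Qed.

Lemma walk_sym n A B : walk (@interl_adj k) n A B -> walk (@interl_adj k) n B A.
Proof.
elim: n A => [A /= ->//|n IH A [D [AD /IH DB]]].
rewrite -addn1; apply: walk_cat DB _; exists A; split=> //; exact: interl_adj_sym.
Qed.

(** One interlacing step raises each a_i to the minimum of c_i and a_{i+1}, and the last element to
    that of [C]. The shift separating the result from [C] is then smaller by one. *)
Lemma walk_up r A C : (forall i, (i < k)%N -> (ksub_elt A i <= ksub_elt C i)%N) ->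
  (forall i, (i + r < k)%N -> (ksub_elt C i <= ksub_elt A (i + r))%N) ->
  exists2 n, (n <= r)%N & walk (@interl_adj k) n A C.
Proof.
elim: r A => [A AC CA|r IH A AC CA].
  exists 0%N => //; apply: ksub_ext => i ik; apply/eqP.
  by rewrite eqn_leq AC//= -{2}[i]addn0 CA// addn0.
pose g i := if (i.+1 < k)%N then minn (ksub_elt C i) (ksub_elt A i.+1) else ksub_elt C i.
have [D HD] : exists D : ksub k, forall i, (i < k)%N -> ksub_elt D i = g i.
  apply: ksub_of_fun => i ik; rewrite /g ik; have Ci := ksub_elt_lt C (ltnSn i) ik.
  case: ifP => i2k; last by rewrite gtn_min Ci.
  rewrite leq_min (leq_ltn_trans (geq_minl _ _) Ci)/=.
  exact: leq_ltn_trans (geq_minr _ _) (ksub_elt_lt A (ltnSn _) i2k).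
have AD i : (i < k)%N -> (ksub_elt A i <= ksub_elt D i)%N.
  move=> ik; rewrite HD// /g; case: ifP => i1k; last exact: AC.
  by rewrite leq_min AC//= ksub_elt_le.
have DA i : (i.+1 < k)%N -> (ksub_elt D i <= ksub_elt A i.+1)%N.
  by move=> ik; rewrite HD ?(ltnW ik)// /g ik geq_minr.
have DC i : (i < k)%N -> (ksub_elt D i <= ksub_elt C i)%N.
  by move=> ik; rewrite HD// /g; case: ifP => // _; exact: geq_minl.
have [||n nr W] := IH D.
- exact: DC.
- move=> i irk; rewrite [ksub_elt D (i + r)]HD// /g; case: ifP => ir1.
    rewrite leq_min -addnS CA ?addnS// andbT; apply: ksub_elt_le => //; exact: leq_addr.
  by apply: ksub_elt_le => //; exact: leq_addr.
(* Adjacent sets are distinct, so a trivial step is left out. *)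
have [E|AnD] := pselect (A = D); first by exists n; rewrite ?E// leqW.
exists n.+1 => //; exists D; split=> //; split=> //; left; split=> [i ik|k0].
  by split; [apply: AD; exact: ltnW|exact: DA].
by apply: AD; rewrite prednK.
Qed.

(** Both sets climb to their termwise maximum, in at most [r] steps each. *)
Lemma walk_bound r A B :
  (forall i, (i + r < k)%N -> (ksub_elt A i <= ksub_elt B (i + r))%N) ->
  (forall i, (i + r < k)%N -> (ksub_elt B i <= ksub_elt A (i + r))%N) ->
  exists2 n, (n <= r + r)%N & walk (@interl_adj k) n A B.
Proof.
move=> AB BA.
have [C HC] : exists C, forall i, (i < k)%N -> ksub_elt C i = maxn (ksub_elt A i) (ksub_elt B i).
  apply: ksub_of_fun => i ik; rewrite gtn_max leq_max ksub_elt_lt//=.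
  by rewrite leq_max (ksub_elt_lt B)// orbT.
have [||n nr W1] := @walk_up r A C.
- by move=> i ik; rewrite HC// leq_maxl.
- move=> i irk; have ik := leq_ltn_trans (leq_addr r i) irk.
  by rewrite HC// geq_max BA// andbT ksub_elt_le// leq_addr.
have [||m mr W2] := @walk_up r B C.
- by move=> i ik; rewrite HC// leq_maxr.
- move=> i irk; have ik := leq_ltn_trans (leq_addr r i) irk.
  by rewrite HC// geq_max AB//= ksub_elt_le// leq_addr.
by exists (n + m)%N; [exact: leq_add|apply: walk_cat W1 _; exact: walk_sym].
Qed.

(** Tail counts are the coordinates of an embedding into c_0: they vanish for large [n] and change
    by at most one along an edge. *)
Definition cnt (n : nat) A := count (leq n) (sval A).

Lemma cnt_eq0 n A : (sumn (sval A) < n)%N -> cnt n A = 0%N.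
Proof.
move=> nA; apply/eqP; rewrite -leqn0 leqNgt -has_count; apply/negP => /hasP[i iA ni].
have : (i <= sumn (sval A))%N by rewrite sumnE (big_rem i)//= leq_addr.
lia.
Qed.

(** The entry of index [size s - j] is the [j]-th largest. *)
Lemma count_ge_sorted n j (s : seq nat) : sorted ltn s -> (0 < j <= size s)%N ->
  (j <= count (leq n) s)%N = (n <= nth 0 s (size s - j))%N.
Proof.
elim: s => [|x s IH] /=; first by move=> _; rewrite leqn0; case: j.
move=> xs /andP[j0 js]; have ss := path_sorted xs.
have allx : (n <= x)%N -> count (leq n) s = size s.
  move=> nx; apply/eqP; rewrite -all_count; apply/allP => y ys.
  have /allP/(_ y ys) := order_path_min ltn_trans xs.
  by move=> /ltnW; exact: leq_trans.
have [jj|jss] := leqP j (size s).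
  rewrite subSn//= -IH ?j0//.
  by have [nx|xn] := leqP n x; rewrite ?add0n// allx//; apply/idP/idP; lia.
have -> : j = (size s).+1 by lia.
rewrite subnn /=; have [nx|xn] := leqP n x; first by rewrite allx//; lia.
by rewrite add0n ltnNge count_size.
Qed.

Lemma cnt_ge n j A : (0 < j <= k)%N -> (j <= cnt n A)%N = (n <= ksub_elt A (k - j))%N.
Proof.
by move=> jk; rewrite /cnt count_ge_sorted ?ksub_size//; exact: ksub_sorted.
Qed.

Lemma cnt_le n A : (cnt n A <= k)%N.
Proof. by have := count_size (leq n) (sval A); rewrite ksub_size. Qed.

Lemma cnt_interl n A B : interl A B -> (cnt n A <= cnt n B <= (cnt n A).+1)%N.
Proof.
move=> [H1 H2]; have AB i : (i < k)%N -> (ksub_elt A i <= ksub_elt B i)%N.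
  move=> ik; have [i1|i1] := ltnP i.+1 k; first by case: (H1 i i1).
  by have -> : i = k.-1 by [lia]; apply: H2; lia.
apply/andP; split.
  case E : (cnt n A) => [//|j]; have jk : (0 < j.+1 <= k)%N by have := cnt_le n A; rewrite E.
  rewrite cnt_ge//; apply: leq_trans (AB _ _); last by lia.
  by rewrite -cnt_ge// E.
case E : (cnt n B) => [//|[//|j]]; have jk : (0 < j.+2 <= k)%N by have := cnt_le n B; rewrite E.
rewrite ltnS cnt_ge; last by lia.
have : (n <= ksub_elt B (k - j.+2))%N by rewrite -cnt_ge// E.
move=> /leq_trans; apply; have [|_] := H1 (k - j.+2)%N; first by lia.
by have -> : ((k - j.+2).+1 = k - j.+1)%N by lia.
Qed.

Lemma cnt_walk n m A B : walk (@interl_adj k) m A B -> (cnt n A <= cnt n B + m)%N.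
Proof.
elim: m A => [A /= ->|m IH A /= [D [[_ AD] /IH DB]]]; first by rewrite addn0.
have : (cnt n A <= (cnt n D).+1)%N.
  by case: AD => /(cnt_interl n); lia.
by move=> H; apply: leq_trans H _; rewrite addnS ltnS.
Qed.

(** Test with [n := ksub_elt A i]: at least k - i elements of [A], hence at least k - i - r elements
    of [B], reach this value. *)
Lemma cnt_close r A B : (forall n, (cnt n A <= cnt n B + r)%N) ->
  forall i, (i + r < k)%N -> (ksub_elt A i <= ksub_elt B (i + r))%N.
Proof.
move=> H i irk; have := H (ksub_elt A i).
have kA : (k - i <= cnt (ksub_elt A i) A)%N.
  rewrite cnt_ge; last by lia.
  by have -> : (k - (k - i) = i)%N by lia.
move=> H1; have : (k - (i + r) <= cnt (ksub_elt A i) B)%N by lia.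
rewrite cnt_ge; last by lia.
by have -> : (k - (k - (i + r)) = i + r)%N by lia.
Qed.

Section Dist.
Variable R : realType.
Local Notation d := (@interl_dist R k).

Lemma interl_dist_le n A B : walk (@interl_adj k) n A B -> d A B <= n%:R.
Proof.
move=> W; apply: ge_inf; last by exists n.
by exists 0 => _ [m _ <-].
Qed.

(** Walks exist, since the hypotheses of [walk_bound] are vacuous for r = k; the infimum is attained
    because lengths are natural numbers. *)
Lemma interl_distP A B : exists2 n, walk (@interl_adj k) n A B & d A B = n%:R.
Proof.
have ex : exists n, `[< walk (@interl_adj k) n A B >].
  by have [||n _ W] := @walk_bound k A B; [lia|lia|exists n; exact/asboolP].
case: (ex_minnP ex) => n /asboolP W nmin; exists n => //.
apply/eqP; rewrite eq_le interl_dist_le//=; apply: lb_le_inf; first by exists n%:R, n.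
by move=> _ [m Wm <-]; rewrite ler_nat; apply: nmin; exact/asboolP.
Qed.

Lemma interl_dist_bound r A B :
  (forall i, (i + r < k)%N -> (ksub_elt A i <= ksub_elt B (i + r))%N) ->
  (forall i, (i + r < k)%N -> (ksub_elt B i <= ksub_elt A (i + r))%N) ->
  d A B <= (r + r)%:R.
Proof.
move=> AB BA; have [n nr W] := walk_bound AB BA.
by apply: le_trans (interl_dist_le W) _; rewrite ler_nat.
Qed.

Lemma interl_dist_diam A B : d A B <= (k + k)%:R.
Proof. by apply: interl_dist_bound => i; lia. Qed.

Lemma interl_dist_ge n A B : (cnt n B)%:R - (cnt n A)%:R <= d A B.
Proof.
have [m W ->] := interl_distP A B; have := cnt_walk n (walk_sym W).
by rewrite -(ler_nat R) natrD; lra.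
Qed.

Lemma interl_dist_sym A B : d A B = d B A.
Proof.
have le C D : d C D <= d D C.
  by have [m W ->] := interl_distP D C; exact: interl_dist_le (walk_sym W).
by apply/eqP; rewrite eq_le !le.
Qed.

Lemma interl_dist_metric : is_metric d.
Proof.
split.
- by move=> A B; have [n _ ->] := interl_distP A B.
- move=> A B; split=> [|->].
    by have [[|n] W ->] := interl_distP A B => // /eqP; rewrite pnatr_eq0.
  have [n _ E] := interl_distP B B; apply/eqP; rewrite eq_le {2}E ler0n andbT.
  exact: (@interl_dist_le 0).
- exact: interl_dist_sym.
- move=> A B C; have [n W ->] := interl_distP A B; have [m W' ->] := interl_distP B C.
  by rewrite -natrD; apply: interl_dist_le; exact: walk_cat W W'.
Qed.

Lemma interl_dist_ge1 A B : A <> B -> 1 <= d A B.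
Proof.
move=> AB; have [[|n] W ->] := interl_distP A B; first by case: AB.
by rewrite ler1n.
Qed.

Lemma cnt_c0_subproof A : (fun n => (cnt n A)%:R) @ \oo --> (0 : R).
Proof.
apply/cvg_seqP => e e0; exists (sumn (sval A)).+1 => n nA.
by rewrite subr0 cnt_eq0// normr0 ltW.
Qed.

Definition cnt_c0 A : c0 R := exist _ (fun n => (cnt n A)%:R) (cnt_c0_subproof A).

Lemma cnt_c0_le A B : c0_dist (cnt_c0 A) (cnt_c0 B) <= d A B.
Proof.
apply: c0_dist_le => n /=; rewrite ler_norml.
have := interl_dist_ge n A B; have := interl_dist_ge n B A; rewrite (interl_dist_sym B A).
by move=> H1 H2; apply/andP; split; lra.
Qed.

Lemma cnt_c0_ge A B : d A B <= 2 * c0_dist (cnt_c0 A) (cnt_c0 B).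
Proof.
set D := c0_dist _ _; have D0 : 0 <= D := c0_dist_ge0 _ _.
have HD n : (cnt n A)%:R <= (cnt n B)%:R + D /\ (cnt n B)%:R <= (cnt n A)%:R + D.
  by have := c0_dist_ub (cnt_c0 A) (cnt_c0 B) n; rewrite /= ler_norml -/D => /andP[]; split; lra.
(* Counts are integers, so their differences are at most the integer part of [D]. *)
pose r := Num.truncn D.
have /andP[rD Dr] : r%:R <= D < r.+1%:R by exact: truncn_itv.
have close (a b : nat) : a%:R <= b%:R + D -> (a <= b + r)%N.
  move=> H; rewrite -ltnS -addnS -(ltr_nat R) natrD; lra.
have := @interl_dist_bound r A B.
move=> /(_ _ _)/le_trans; apply; last by rewrite natrD; lra.
- by apply: cnt_close => n; apply: close; case: (HD n).
- by apply: cnt_close => n; apply: close; case: (HD n).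
Qed.

End Dist.
End Ksub.

Lemma itl_nth l n T : itl l n T -> forall i, (i < size l)%N -> (nth 0 l i <= nth 0 n i)%N /\
  ((i.+1 < size l)%N -> (nth 0 n i <= nth 0 l i.+1)%N).
Proof.
elim=> // {}l {}n {}T a b T' it IH Ta ab bT i; have sz := itl_size it.
have [_ _ _ /allP nT] := itl_sorted it.
rewrite size_rcons ltnS !nth_rcons -sz => il; split.
  by case: ltngtP il => // il _; case: (IH i il).
rewrite ltnS => il'; rewrite il'; have [il1|il1] := ltnP i.+1 (size l).
  by case: (IH i il') => _; apply.
have -> : i.+1 == size l by lia.
by apply: leq_trans Ta; apply/ltnW/nT; rewrite mem_nth// -sz.
Qed.

Lemma itl_dist (R : realType) (k : nat) (A B : ksub k) T : itl (sval A) (sval B) T ->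
  interl_dist R A B <= 1.
Proof.
move=> /itl_nth; rewrite ksub_size => H.
have [||n n1 W] := @walk_up k 1 A B.
- by move=> i /H[].
- by move=> i; rewrite addn1 => i1; have [_ ] := H i (ltnW i1); apply.
by apply: le_trans (interl_dist_le R W) _; rewrite (ler_nat R n 1).
Qed.

Section Conclude.
Variables (R : realType) (X : completeNormedModType R) (le : X -> X -> Prop).

Lemma c0_of_interlacing : is_banach_lattice le -> separable X ->
  equi_coarse_embeds (fun k => @interl_dist R k) (@norm_dist R X) -> c0_iso_embeds X.
Proof.
move=> HL sepX [rho [om [[rho0 rhom] [om0 omm] rhoy Hf]]].
apply: contrapT => /(kb_of_not_c0 HL) KB.
set w := om 1; have w0 : 0 <= w by apply: om0.
(* The threshold is twice the radius 2 w + 2 of [concentration]. *)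
have [k Hk] : exists k : nat, 4 * w + 4 < rho k%:R.
  move/cvgryPgt/(_ (4 * w + 4)) : rhoy => [t [_ Ht]].
  exists (Num.bound `|t|).+1; apply: Ht => /=.
  apply: le_lt_trans (ler_norm t) _; apply: lt_trans (archi_boundP (normr_ge0 t)) _.
  by rewrite ltr_nat.
have [f fP] := Hf k.
(* [concentration] is about maps on all finite sequences, so [f] is extended by 0. *)
pose g (s : seq nat) : X :=
  if insub s : option {s : seq nat | (size s == k) && sorted ltn s} is Some A then f A else 0.
have gE (A : ksub k) : g (sval A) = f A by rewrite /g; case: A => s Ps /=; rewrite insubT.
have gout s : ~~ ((size s == k) && sorted ltn s) -> g s = 0 by move=> Ps; rewrite /g insubN.
have [A0 _] : exists A : ksub k, forall i, (i < k)%N -> ksub_elt A i = i by exact: ksub_of_fun.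
have gM s : `|g s| <= `|f A0| + om (k + k)%:R.
  have [Ps|Ps] := boolP ((size s == k) && sorted ltn s); last first.
    by rewrite gout// normr0 addr_ge0// om0.
  rewrite (gE (exist _ s Ps)) -[f (exist _ s Ps)](subrK (f A0)) addrC.
  apply: le_trans (ler_normD _ _) _; rewrite lerD2l.
  have /andP[_] := fP (exist _ s Ps) A0; move=> /le_trans; apply.
  by apply: omm; [case: (interl_dist_metric k R)|exact: interl_dist_diam].
have gw l n T : itl l n T -> size l = k -> `|g l - g n| <= w.
  move=> it sl; have [ls ns _ _] := itl_sorted it.
  have Pl : (size l == k) && sorted ltn l by rewrite sl eqxx.
  have Pn : (size n == k) && sorted ltn n by rewrite -(itl_size it) sl eqxx.
  rewrite (gE (exist _ l Pl)) (gE (exist _ n Pn)).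
  have /andP[_] := fP (exist _ l Pl) (exist _ n Pn); move=> /le_trans; apply.
  by apply: omm; [case: (interl_dist_metric k R)|exact: (itl_dist R (A := exist _ l Pl) (B := exist _ n Pn) it)].
have [x Hx] := concentration HL KB sepX gM gw.
(* No element of [m] exceeds [sumn m], so at the threshold [(sumn m).+1] the tail count is 0 for [m]
   and [k] for [m']. *)
have [m [sm ms _ mx]] := Hx 0%N; have [m' [sm' ms' m'T m'x]] := Hx (sumn m).+1.
have Pm : (size m == k) && sorted ltn m by rewrite sm eqxx.
have Pm' : (size m' == k) && sorted ltn m' by rewrite sm' eqxx.
have kd : k%:R <= interl_dist R (exist _ m Pm : ksub k) (exist _ m' Pm').
  have := @interl_dist_ge k R (sumn m).+1 (exist _ m Pm) (exist _ m' Pm').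
  rewrite (cnt_eq0 (A := exist _ m Pm))// subr0; apply: le_trans; rewrite ler_nat.
  by rewrite /cnt /= -sm' leq_eqVlt eq_sym -all_count m'T.
have /andP[+ _] := fP (exist _ m Pm) (exist _ m' Pm').
rewrite /norm_dist -(gE (exist _ m Pm)) -(gE (exist _ m' Pm')) /= => H.
have := rhom _ _ (ler0n _ k) kd.
have := ler_distD x (g m) (g m'); rewrite (distrC x).
lra.
Qed.

End Conclude.

(** * Metric elasticity *)

Section Aharoni.
Variables (R : realType) (T : Type) (d : T -> T -> R) (m : nat -> T).
Hypothesis dm : is_metric d.
Hypothesis mdense : forall x (e : R), 0 < e -> exists i, d x (m i) < e.

Let d0 x y : 0 <= d x y. Proof. by case: dm. Qed.
Let dxx x : d x x = 0. Proof. by case: dm => _ /(_ x x)[_ ->]. Qed.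
Let dC x y : d x y = d y x. Proof. by case: dm. Qed.
Let dtri x y z : d x z <= d x y + d y z. Proof. by case: dm. Qed.

(** A partition into sets of diameter at most 4t: each point goes to the first centre within 2t. *)
Definition piece (t : R) (i : nat) : set T :=
  [set x | d x (m i) < 2 * t /\ forall j, (j < i)%N -> 2 * t <= d x (m j)].

(* The tent [max 0 (t - d(x, piece t i))]; the value 0 is added to the set so that
   the formula also makes sense when the piece is empty. *)
Definition tent (t : R) (i : nat) (x : T) : R :=
  sup [set r | r = 0 \/ exists2 a, piece t i a & r = t - d x a].

Section Bump.
Variables (t : R) (i : nat).
Hypothesis t0 : 0 < t.

Lemma tent_set_sup x : has_sup [set r | r = 0 \/ exists2 a, piece t i a & r = t - d x a].
Proof.
split; first by exists 0; left.
by exists t => _ [->|[a _ ->]]; [exact: ltW|have := d0 x a; lra].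
Qed.

Lemma tent_ge0 x : 0 <= tent t i x.
Proof. by apply: ub_le_sup; [case: (tent_set_sup x)|left]. Qed.

Lemma tent_ge x a : piece t i a -> t - d x a <= tent t i x.
Proof. by move=> ia; apply: ub_le_sup; [case: (tent_set_sup x)|right; exists a]. Qed.

Lemma tent_le x M : 0 <= M -> (forall a, piece t i a -> t - d x a <= M) -> tent t i x <= M.
Proof.
by move=> M0 H; apply: ge_sup => [|_ [->//|[a /H ? ->//]]]; case: (tent_set_sup x).
Qed.

Lemma tent_le_t x : tent t i x <= t.
Proof. by apply: tent_le => [|a _]; [exact: ltW|have := d0 x a; lra]. Qed.

Lemma tent_lip x y : tent t i x <= tent t i y + d x y.
Proof.
apply: tent_le => [|a ia]; first by rewrite addr_ge0// tent_ge0.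
by have := tent_ge y ia; have := dtri y x a; rewrite (dC y x); lra.
Qed.

Lemma tent_eq0 x : (forall a, piece t i a -> t <= d x a) -> tent t i x = 0.
Proof.
move=> H; apply/eqP; rewrite eq_le tent_ge0 andbT.
by apply: tent_le => // a /H; lra.
Qed.

(** A point within [t] of [m j] is at least [t] away from all later pieces. This is what brings the
    coordinates into c_0. *)
Lemma tent_far j x : (j < i)%N -> d x (m j) < t -> tent t i x = 0.
Proof.
move=> ji xj; apply: tent_eq0 => a [_ /(_ j ji)].
by have := dtri a x (m j); rewrite (dC a x); lra.
Qed.

(** A piece has diameter at most 4t, so [y] is farther than [t] from the piece of [x]. *)
Lemma tent_sep x y : piece t i x -> 6 * t <= d x y -> tent t i x - tent t i y = t.
Proof.
move=> ix xy; have -> : tent t i x = t.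
  by apply/eqP; rewrite eq_le tent_le_t/=; have := tent_ge x ix; rewrite dxx subr0.
rewrite tent_eq0 ?subr0// => a [ia _]; have [xi _] := ix.
have H1 := dtri x (m i) a; have H2 := dtri x a y; rewrite (dC (m i) a) in H1.
rewrite (dC a y) in H2.
by have t1 := t0; lra.
Qed.

End Bump.

Lemma piece_cover t x : 0 < t -> exists i, piece t i x.
Proof.
move=> t0; have ex : exists i, d x (m i) < 2 * t by apply: mdense; lra.
case: (ex_minnP ex) => i xi imin; exists i; split=> // j ji.
by rewrite leNgt; apply/negP => /imin; lia.
Qed.

(** The piece of index 0 is avoided, so that coordinates vanish at scales above d x (m 0). Nothing
    is lost: [x] and [y] are 6t apart and cannot both lie in it. *)
Lemma separating_tent t x y : 0 < t -> 6 * t <= d x y ->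
  exists i, t <= `|tent t i.+1 x - tent t i.+1 y|.
Proof.
move=> t0 xy; have [i ix] := piece_cover x t0; have [j jy] := piece_cover y t0.
have yx : 6 * t <= d y x by rewrite dC.
case: i ix => [|i] ix; last by exists i; rewrite (tent_sep t0 ix xy) ger0_norm// ltW.
case: j jy => [|j] jy; last by exists j; rewrite distrC (tent_sep t0 jy yx) ger0_norm// ltW.
have := dtri x (m 0%N) y; rewrite (dC (m 0%N) y).
by case: ix => ? _; case: jy => ? _; lra.
Qed.

(** All integral powers of two, [b] giving the sign of the exponent. *)
Definition dyadic_scale (b : bool) (p : nat) : R := if b then 2 ^+ p else 2^-1 ^+ p.

Lemma dyadic_scale_gt0 b p : 0 < dyadic_scale b p.
Proof. by rewrite /dyadic_scale; case: b; rewrite exprn_gt0 ?invr_gt0. Qed.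

Lemma pow2_large (r : R) : exists p, forall q, (p <= q)%N -> r < 2 ^+ q.
Proof.
exists (Num.bound `|r|) => q pq; apply: le_lt_trans (ler_norm r) _.
apply: lt_trans (archi_boundP (normr_ge0 r)) _; rewrite -natrX ltr_nat.
exact: leq_ltn_trans pq (ltn_expl q (isT : (1 < 2)%N)).
Qed.

Lemma half_pow_small (r : R) : 0 < r -> exists p, forall q, (p <= q)%N -> 2^-1 ^+ q < r.
Proof.
move=> r0; have [p Hp] := pow2_large r^-1; exists p => q /Hp.
by rewrite exprVn -{2}[r]invrK ltf_pV2 ?posrE ?exprn_gt0 ?invr_gt0.
Qed.

(** 6 is the separation required by [separating_tent]; consecutive scales differ by a factor 2,
    whence 12. *)
Lemma dyadic_scale_exists (D : R) : 0 < D -> exists b p, 6 * dyadic_scale b p <= D <= 12 * dyadic_scale b p.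
Proof.
move=> D0; have [D6|D6] := ltP D 6.
  have ex : exists p, 6 * 2^-1 ^+ p <= D.
    have D60 : 0 < D / 6 by lra.
    by have [p /(_ p (leqnn p))] := half_pow_small D60; exists p; lra.
  case: (ex_minnP ex) => -[|p] Hp pmin; first by move: Hp; rewrite expr0; lra.
  exists false, p.+1; rewrite /dyadic_scale Hp/= exprS.
  have /negP : ~~ (6 * 2^-1 ^+ p <= D) by apply/negP => /pmin; lia.
  by move=> /negP; rewrite -ltNge; lra.
have ex : exists p, D < 6 * 2 ^+ p.
  by have [p /(_ p (leqnn p))] := pow2_large (D / 6); exists p; lra.
case: (ex_minnP ex) => -[|p] Hp pmin; first by move: Hp; rewrite expr0; lra.
exists true, p; rewrite /dyadic_scale; move: Hp; rewrite exprS => Hp.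
have : ~~ (D < 6 * 2 ^+ p) by apply/negP => /pmin; lia.
by rewrite -leNgt; lra.
Qed.

(** With [pickle_inv] each triple owns a single index; a triple repeated at infinitely many indices
    could prevent convergence to 0. *)
Definition tent_coord (x : T) (n : nat) : R :=
  if pickle_inv n is Some (b, p, i) then tent (dyadic_scale b p) i.+1 x else 0.

Lemma tent_coord_lip x y n : `|tent_coord x n - tent_coord y n| <= d x y.
Proof.
rewrite /tent_coord; case: pickle_inv => [[[b p] i]|]; last by rewrite subr0 normr0.
have := tent_lip i.+1 (dyadic_scale_gt0 b p) x y; have := tent_lip i.+1 (dyadic_scale_gt0 b p) y x.
by rewrite (dC y x) ler_norml => H1 H2; apply/andP; split; lra.
Qed.

(* At scale [t], the tent vanishes at [x] if [d x (m 0) < t] and is at most [t];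
   in between, only finitely many scales and, at each of them, finitely many
   indices are left. *)
Lemma tent_coord_cvg x : tent_coord x @ \oo --> (0 : R).
Proof.
apply/cvg_seqP => e e0.
have [p1 Hp1] := half_pow_small e0; have [p2 Hp2] := pow2_large (d x (m 0%N)).
pose K := maxn p1 p2.
have fin b p : exists N, forall n i, (N <= n)%N -> pickle_inv n = Some (b, p, i) ->
    tent (dyadic_scale b p) i.+1 x = 0.
  have [j Hj] := mdense x (dyadic_scale_gt0 b p).
  have [N HN] : exists N, forall i, (i <= j)%N -> (pickle (b, p, i) < N)%N.
    by apply: ex_max => [i N M NM iN|i]; [exact: leq_trans iN NM|exists (pickle (b, p, i)).+1].
  exists N => n i Nn E.
  have En : pickle (b, p, i) = n.
    by have := pickle_invK (T := (bool * nat * nat)%type) n; rewrite E.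
  apply: (tent_far (dyadic_scale_gt0 b p) (j := j)) => //.
  by rewrite ltnS leqNgt; apply/negP => ij; have := HN i (ltnW ij); rewrite En; lia.
have [N HN] : exists N, forall p, (p <= K)%N -> forall b n i, (N <= n)%N ->
    pickle_inv n = Some (b, p, i) -> tent (dyadic_scale b p) i.+1 x = 0.
  apply: ex_max => [p N M NM H b n i Mn|p]; first by apply: H; exact: leq_trans NM Mn.
  have [N1 H1] := fin true p; have [N2 H2] := fin false p.
  exists (maxn N1 N2) => -[] n i; rewrite geq_max => /andP[n1 n2]; [exact: H1|exact: H2].
exists N => n Nn; rewrite subr0 /tent_coord.
case E : (pickle_inv n) => [[[b p] i]|]; last by rewrite normr0 ltW.
rewrite ger0_norm ?tent_ge0 ?dyadic_scale_gt0//.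
have [pK|Kp] := leqP p K; first by rewrite (HN p pK b n i Nn E) ltW.
case: b E => _.
  rewrite (tent_far (dyadic_scale_gt0 true p) (j := 0%N)) ?ltW//= /dyadic_scale.
  by apply: Hp2; rewrite /K in Kp; lia.
apply: le_trans (tent_le_t _ (dyadic_scale_gt0 false p) _) _; apply: ltW.
by apply: Hp1; rewrite /K in Kp; lia.
Qed.

Definition aharoni_map (x : T) : c0 R := exist _ (tent_coord x) (tent_coord_cvg x).

Lemma aharoni x y : d x y <= 12 * c0_dist (aharoni_map x) (aharoni_map y) /\
  c0_dist (aharoni_map x) (aharoni_map y) <= d x y.
Proof.
split; last by apply: c0_dist_le => n; exact: tent_coord_lip.
have := d0 x y; rewrite le_eqVlt => /orP[/eqP <-|D0].
  by rewrite mulr_ge0// c0_dist_ge0.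
have [b [p /andP[H1 H2]]] := dyadic_scale_exists D0.
have [i Hi] := separating_tent (dyadic_scale_gt0 b p) H1.
have := c0_dist_ub (aharoni_map x) (aharoni_map y) (pickle (b, p, i)).
by rewrite /= /tent_coord pickleK_inv; lra.
Qed.

End Aharoni.

(** * Elasticity and separated sequences *)

Section Elastic.
Variables (R : realType) (X : completeNormedModType R).

(** A subset of a separable metric space is separable: a preimage is chosen for every small ball
    around some [q a] that meets the image, with [x0] as default. *)
Lemma bilip_separable (T : Type) (d : T -> T -> R) (x0 : T) : separable X ->
  bilip_embeds d (@norm_dist R X) ->
  exists m : nat -> T, forall x (e : R), 0 < e -> exists i, d x (m i) < e.
Proof.
move=> /separableP[q qP] [f [K [s s0 fP]]].
have ex (ab : nat * nat) : exists t, (exists t', `|f t' - q ab.1| < ab.2.+1%:R^-1) ->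
    `|f t - q ab.1| < ab.2.+1%:R^-1.
  have [[t Ht]|n] := pselect (exists t', `|f t' - q ab.1| < ab.2.+1%:R^-1); first by exists t.
  by exists x0.
pose pt ab := sval (cid (ex ab)).
exists (fun n => if unpickle n is Some ab then pt ab else x0) => x e e0.
have se0 : 0 < s * e / 3 by rewrite divr_gt0// mulr_gt0.
have [b /(_ b (leqnn b)) Hb] := inv_nat_small se0.
have b0 : 0 < b.+1%:R^-1 :> R by rewrite invr_gt0.
have [a Ha] := qP (f x) _ b0.
exists (pickle (a, b)); rewrite pickleK.
have : `|f (pt (a, b)) - q a| < b.+1%:R^-1.
  by rewrite /pt; case: cid => t /=; apply; exists x; rewrite distrC.
move: (b.+1%:R^-1 : R) Hb b0 Ha => r Hr r0 Ha Hp.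
have /andP[H _] := fP x (pt (a, b)); move: H; rewrite /norm_dist => H.
rewrite -(ltr_pM2l s0); apply: le_lt_trans H _.
apply: le_lt_trans (ler_distD (q a) _ _) _; rewrite [`|q a - f (pt _)|]distrC [`|f x - q a|]distrC; lra.
Qed.

Lemma elastic_of_c0 : separable X -> c0_iso_embeds X -> metric_elastic (@norm_dist R X).
Proof.
move=> sepX /c0_iso_bilip[T0 [a [b [a0 b0 HT]]]].
(* The distortions 12 of [aharoni] and b / a of [T0] multiply; the summand 1 secures 1 <= K. *)
exists (1 + 12 * b / a); first by rewrite lerDl divr_ge0 ?mulr_ge0// ltW.
move=> T d dm emb; have [[x0 _]|empty] := pselect (exists x : T, True); last first.
  by exists (fun=> 0), 1 => // x; case: empty; exists x.
have [m mP] := bilip_separable x0 sepX emb.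
exists (T0 \o aharoni_map dm mP), (a / 12) => [|x y]; first by rewrite divr_gt0.
have [H1 H2] := aharoni dm mP x y; have /andP[H3 H4] := HT (aharoni_map dm mP x) (aharoni_map dm mP y).
rewrite /norm_dist /=; apply/andP; split.
  apply: le_trans H3; rewrite -mulrA ler_pM2l//; lra.
apply: (le_trans H4).
have -> : (1 + 12 * b / a) * (a / 12) * d x y = (a / 12) * d x y + b * d x y by field; lra.
have d0 : 0 <= d x y by have [H _ _ _] := dm.
apply: (@le_trans _ _ (b * d x y)); first by rewrite ler_pM2l.
by rewrite lerDr mulr_ge0// divr_ge0// ltW.
Qed.

Hypothesis infX : infinite_dimensional X.

(* Otherwise the unit ball lies within 1/2 of a finite subset of itself, and by
   iteration the span of that finite set is dense. *)
Lemma separated_extension (s : seq X) : exists x, `|x| <= 1 /\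
  forall i, (i < size s)%N -> 2^-1 <= `|x - nth 0 s i|.
Proof.
apply: contrapT => Hn; pose N := size s.
have near1 x : `|x| <= 1 -> exists i : 'I_N, `|x - nth 0 s i| <= 2^-1.
  move=> x1; apply: contrapT => H; apply: Hn; exists x; split=> // i iN.
  by rewrite leNgt; apply/negP => /ltW xi; apply: H; exists (Ordinal iN).
pose comb (c : 'rV[R]_N) := \sum_(i < N) c 0 i *: nth 0 s i.
have combD c c' : comb (c + c') = comb c + comb c'.
  by rewrite /comb -big_split; apply: eq_bigr => i _; rewrite mxE scalerDl.
have comb1 (r : R) i : comb (r *: delta_mx 0 i) = r *: nth 0 s i.
  rewrite /comb (bigD1 i)//= big1 ?addr0 => [|j ji]; first by rewrite !mxE !eqxx mulr1.
  by rewrite !mxE (negPf ji) andbF mulr0 scale0r.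
have nearr (r : R) x : 0 < r -> `|x| <= r -> exists c, `|x - comb c| <= r / 2.
  move=> r0 xr; have x1 : `|r^-1 *: x| <= 1.
    rewrite normrZ gtr0_norm ?invr_gt0// -(mulVf (lt0r_neq0 r0)).
    by rewrite ler_wpM2l// invr_ge0 ltW.
  have [i Hi] := near1 _ x1; exists (r *: delta_mx 0 i); rewrite comb1.
  have -> : x - r *: nth 0 s i = r *: (r^-1 *: x - nth 0 s i).
    by rewrite scalerBr scalerA mulfV ?scale1r// gt_eqF.
  by rewrite normrZ gtr0_norm// ler_wpM2l// ltW.
have dense x (e : R) : 0 < e -> exists c, `|x - comb c| <= e.
  move=> e0; have it p : exists c, `|x - comb c| <= (`|x| + 1) * 2^-1 ^+ p.
    elim: p => [|p [c Hc]].
      by exists 0; rewrite expr0 mulr1 /comb big1 ?subr0 ?lerDl// => i _; rewrite mxE scale0r.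
    have r0 : 0 < (`|x| + 1) * 2^-1 ^+ p.
      by rewrite mulr_gt0 ?exprn_gt0 ?invr_gt0// ltr_wpDl.
    have [c' Hc'] := nearr _ _ r0 Hc; exists (c + c').
    by rewrite combD opprD addrA exprSr mulrA.
  have e'0 : 0 < e / (`|x| + 1) by rewrite divr_gt0// ltr_wpDl.
  have [p /(_ p (leqnn p)) Hp] := half_pow_small e'0.
  have [c Hc] := it p; exists c; apply: (le_trans Hc).
  by rewrite mulrC -ler_pdivlMr ?ltr_wpDl// ltW.
have [v vfree] := infX N.+1.
pose F (c : 'rV[R]_N.+1) := \sum_(i < N.+1) c 0 i *: v i.
pose A := [set c : 'rV[R]_N.+1 | `|c| = 1].
have Fseq (r : seq 'I_N.+1) : continuous (fun c : 'rV[R]_N.+1 => \sum_(i <- r) c 0 i *: v i).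
  elim: r => [|i r IH] c.
    have -> : (fun c : 'rV[R]_N.+1 => \sum_(i <- [::]) c 0 i *: v i) = fun=> 0.
      by apply/funext => c'; rewrite big_nil.
    exact: cst_continuous.
  have -> : (fun c : 'rV[R]_N.+1 => \sum_(i <- i :: r) c 0 i *: v i) =
      fun c => c 0 i *: v i + \sum_(i <- r) c 0 i *: v i.
    by apply/funext => c'; rewrite big_cons.
  by apply: cvgD (IH c); apply: cvgZr_tmp; exact: coord_continuous.
have Fcont : continuous (fun c => `|F c|).
  by move=> c; exact: (cvg_norm (Fseq (index_enum 'I_N.+1) c)).
have normalized (c : 'rV[R]_N.+1) : c != 0 -> A (`|c|^-1 *: c).
  by move=> c0; rewrite /A /= normrZ normfV normr_id mulVf// normr_eq0.
have A0 : A !=set0.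
  exists (`|const_mx 1 : 'rV[R]_N.+1|^-1 *: const_mx 1); apply: normalized.
  by apply/eqP => /matrixP/(_ 0 0)/eqP; rewrite !mxE oner_eq0.
have Acomp : compact A.
  apply: bounded_closed_compact.
    by exists 1; split=> // x x1 c /= ->; exact: ltW.
  apply: (@closed_comp _ _ (fun c : 'rV[R]_N.+1 => `|c|) [set 1]); last exact: closed_eq.
  by move=> c _; exact: norm_continuous.
(* The norm of [F] attains its minimum on the unit sphere of coefficients; the minimum is positive
   by independence. *)
have [c /set_mem/= cA cmin] := @compact_EVT_min _ R (fun c => `|F c|) A A0 Acomp
  (continuous_subspaceT Fcont).
have Fc0 : 0 < `|F c|.
  rewrite normr_gt0; apply/eqP => /vfree c0.
  have c00 : c = 0 by apply/rowP => i; rewrite c0 mxE.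
  by move: cA; rewrite /A /= c00 normr0 => /eqP; rewrite eq_sym oner_eq0.
have n0 : 0 < N.+1%:R :> R by [].
have e0 : 0 < `|F c| / (2 * N.+1%:R) by rewrite divr_gt0// mulr_gt0.
(* The [v i] are approximated from the span of N vectors. The coefficient matrix has N + 1 rows and
   N columns, so its left kernel contains a unit vector [w], for which |F w| <= |F c| / 2 is below
   the minimum. *)
pose C := \matrix_(i < N.+1) sval (cid (dense (v i) _ e0)).
have CP i : `|v i - comb (row i C)| <= `|F c| / (2 * N.+1%:R).
  by rewrite /C rowK; case: cid.
have [u uC u0] : exists2 u : 'rV[R]_N.+1, u *m C = 0 & u != 0.
  have : kermx C != 0.
    by rewrite kermx_eq0 /row_free neq_ltn ltnS rank_leq_col.
  by move=> /rowV0Pn[u /sub_kermxP uC u0]; exists u.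
have /mem_set/cmin : A (`|u|^-1 *: u) by exact: normalized.
set w := _ *: u.
have w1 : `|w| = 1 by exact: normalized.
have wC : w *m C = 0 by rewrite -scalemxAl uC scaler0.
have FE : F w = \sum_(i < N.+1) w 0 i *: (v i - comb (row i C)).
  under eq_bigr do rewrite scalerBr.
  rewrite sumrB -[LHS]subr0; congr (_ - _).
  rewrite /comb; under [RHS]eq_bigr do rewrite scaler_sumr.
  rewrite exchange_big/= big1// => j _.
  have wCj : \sum_(i < N.+1) w 0 i * C i j = 0.
    by have := congr1 (fun B : 'rV[R]_N => B 0 j) wC; rewrite [LHS]mxE [RHS]mxE.
  transitivity ((\sum_(i < N.+1) w 0 i * C i j) *: s`_j); last by rewrite wCj scale0r.
  by rewrite scaler_suml; apply: eq_bigr => i _; rewrite [row i C 0 j]mxE scalerA.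
have wi i : `|w 0 i| <= 1.
  rewrite -w1 [leRHS]/Num.norm /= mx_normrE.
  exact: (@le_bigmax _ _ _ 0 (fun ij : 'I_1 * 'I_N.+1 => `|w ij.1 ij.2|) (0, i)).
suff : `|F w| <= `|F c| / 2 by lra.
rewrite FE; apply: le_trans (ler_norm_sum _ _ _) _.
apply: (@le_trans _ _ (\sum_(i < N.+1) `|F c| / (2 * N.+1%:R))).
  apply: ler_sum => i _; rewrite normrZ; apply: le_trans (CP i).
  by rewrite ler_piMl.
rewrite sumr_const card_ord -[_ *+ _]mulr_natr le_eqVlt; apply/orP; left; apply/eqP.
by field; rewrite addrC natr1 gt_eqF.
Qed.

Lemma separated_sequence : exists e : nat -> X, (forall n, `|e n| <= 1) /\
  forall n m, n != m -> 2^-1 <= `|e n - e m|.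
Proof.
pose next s := sval (cid (separated_extension s)).
have nextP s : `|next s| <= 1 /\ forall i, (i < size s)%N -> 2^-1 <= `|next s - nth 0 s i|.
  by rewrite /next; case: cid.
pose L n := iter n (fun s => rcons s (next s)) [::].
have szL n : size (L n) = n by elim: n => //= n IH; rewrite size_rcons IH.
have nthL n m : (n < m)%N -> nth 0 (L m) n = next (L n).
  elim: m => // m IH; rewrite ltnS leq_eqVlt /= nth_rcons szL => /orP[/eqP ->|nm].
    by rewrite ltnn eqxx.
  by rewrite nm IH.
exists (fun n => next (L n)); split=> [n|]; first by case: (nextP (L n)).
have H n m : (n < m)%N -> 2^-1 <= `|next (L m) - next (L n)|.
  by move=> nm; have [_ /(_ n)] := nextP (L m); rewrite szL nthL//; apply.
by move=> n m; rewrite neq_ltn => /orP[/H|/H//]; rewrite distrC.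
Qed.

Lemma interlacing_of_elastic : metric_elastic (@norm_dist R X) ->
  equi_bilip_embeds (fun k => @interl_dist R k) (@norm_dist R X).
Proof.
move=> [K K1 KX]; exists 1, K; split=> // [|k]; first lra.
have [e [e1 esep]] := separated_sequence.
have kk0 : 0 < (k + k).+1%:R :> R by [].
have emb : bilip_embeds (@interl_dist R k) (@norm_dist R X).
  pose D : R := (k + k).+1%:R.
  (* Distinct sets are at distance between 1 and [D], and their images between 1/2 and 2: the lower
     factor 1 / (2 D) and the upper factor 2 fit. *)
  exists (fun A => e (pickle (sval A))), (4 * D), ((2 * D)^-1) => [|A B].
    by rewrite invr_gt0 mulr_gt0.
  have -> : 4 * D * (2 * D)^-1 = 2 by rewrite invfM mulrACA mulfV ?gt_eqF// mulr1; field.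
  rewrite /norm_dist; have [->|AB] := pselect (A = B).
    have [_ /(_ B B)[_ ->]// _ _] := @interl_dist_metric k R.
    by rewrite subrr normr0 !mulr0 lexx.
  apply/andP; split.
    apply: (@le_trans _ _ 2^-1); last first.
      apply: esep; apply/eqP => /(pcan_inj (@pickleK _)) /val_inj.
      exact: AB.
    rewrite mulrC ler_pdivrMr ?mulr_gt0//; apply: (le_trans (interl_dist_diam _ _ _)).
    by rewrite mulKf// ler_nat.
  have := @interl_dist_ge1 k R A B AB; have := ler_normB (e (pickle (sval A))) (e (pickle (sval B))).
  have := e1 (pickle (sval A)); have := e1 (pickle (sval B)); lra.
have [f [s s0 fP]] := KX _ _ (@interl_dist_metric k R) emb.
(* Rescaling in [X] removes the factor [s], which may depend on [k]. *)
exists (fun A => s^-1 *: f A) => A B; have /andP[H1 H2] := fP A B.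
have sN0 : s != 0 by rewrite gt_eqF.
rewrite /norm_dist -scalerBr normrZ ger0_norm ?invr_ge0 ?(ltW s0)//.
by apply/andP; split; rewrite -(ler_pM2l s0) mulVKf// ?mul1r// mulrCA mulrA.
Qed.

End Elastic.

(** * The equivalences *)

Section Implications.
Variables (R : realType) (X : completeNormedModType R).

Lemma mul_cvgy (a : R) : 0 < a -> a * t @[t --> +oo] --> +oo.
Proof.
move=> a0; apply/cvgryPgt => A; exists (A / a); split=> [|t]; first exact: num_real.
by rewrite /= ltr_pdivrMr// mulrC.
Qed.

Lemma mul_nondecr (a : R) : 0 <= a -> nondecr_nonneg (fun t => a * t).
Proof. by move=> a0; split=> [t t0|s t _ st]; rewrite ?mulr_ge0// ler_wpM2l. Qed.

Lemma bilip_of_iso : c0_iso_embeds X -> bilip_embeds (@c0_dist R) (@norm_dist R X).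
Proof.
move=> /c0_iso_bilip[T [a [b [a0 b0 H]]]]; exists T, (b / a), a => // u v.
by rewrite divfK ?gt_eqF//; exact: H.
Qed.

Lemma coarse_of_bilip :
  bilip_embeds (@c0_dist R) (@norm_dist R X) -> coarse_embeds (@c0_dist R) (@norm_dist R X).
Proof.
move=> [f [K [s s0 H]]]; exists (fun t => s * t), (fun t => `|K| * s * t), f; split.
- exact/mul_nondecr/ltW.
- by apply: mul_nondecr; rewrite mulr_ge0// ltW.
- exact: mul_cvgy.
- move=> u v; have /andP[-> /le_trans->//] := H u v.
  by rewrite ler_wpM2r ?c0_dist_ge0// ler_wpM2r ?ler_norm// ltW.
Qed.

(** [cnt_c0] embeds every interlacing graph into c_0 with constants 1/2 and 1; the 1/2 reappears
    inside [rho]. *)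
Lemma interlacing_of_coarse : coarse_embeds (@c0_dist R) (@norm_dist R X) ->
  equi_coarse_embeds (fun k => @interl_dist R k) (@norm_dist R X).
Proof.
move=> [rho [om [f [[rho0 rhom] omP rhoy H]]]].
exists (fun t => rho (2^-1 * t)), om; split=> //.
- split=> [t t0|s t s0 st]; first by apply: rho0; rewrite mulr_ge0.
  by apply: rhom; rewrite ?mulr_ge0// ler_wpM2l.
- by apply: cvg_comp rhoy; apply: mul_cvgy; rewrite invr_gt0.
move=> k; exists (fun A => f (cnt_c0 R A)) => A B.
have d0 : 0 <= interl_dist R A B by have [+ _ _ _] := interl_dist_metric k R; apply.
have /andP[H1 H2] := H (cnt_c0 R A) (cnt_c0 R B); apply/andP; split.
  apply: le_trans H1; apply: rhom; first by rewrite mulr_ge0.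
  by have := cnt_c0_ge R A B; lra.
by apply: le_trans H2 _; apply: omP.2; [exact: c0_dist_ge0|exact: cnt_c0_le].
Qed.

Lemma equi_coarse_of_equi_bilip : equi_bilip_embeds (fun k => @interl_dist R k) (@norm_dist R X) ->
  equi_coarse_embeds (fun k => @interl_dist R k) (@norm_dist R X).
Proof.
move=> [a [b [a0 b0 H]]]; exists (fun t => a * t), (fun t => b * t); split=> //.
- exact/mul_nondecr/ltW.
- exact/mul_nondecr/ltW.
- exact: mul_cvgy.
Qed.

End Implications.

Unset Implicit Arguments.

Theorem theorem5p4 (R : realType) (X : completeNormedModType R)
  (le : X -> X -> Prop) :
  is_banach_lattice le -> separable X -> infinite_dimensional X ->
  [<-> c0_iso_embeds X;
       bilip_embeds (@c0_dist R) (@norm_dist R X);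
       coarse_embeds (@c0_dist R) (@norm_dist R X);
       metric_elastic (@norm_dist R X);
       equi_bilip_embeds (fun k => @interl_dist R k) (@norm_dist R X);
       equi_coarse_embeds (fun k => @interl_dist R k) (@norm_dist R X)].
Proof.
move=> HL sepX infX; tfae.
- exact: bilip_of_iso.
- exact: coarse_of_bilip.
(* A coarse copy of c_0 yields a linear one through the interlacing graphs, after which Aharoni's
   embedding gives elasticity. *)
- by move=> /interlacing_of_coarse/(c0_of_interlacing HL sepX)/(elastic_of_c0 sepX).
- exact: interlacing_of_elastic.
- exact: equi_coarse_of_equi_bilip.
- exact: (c0_of_interlacing HL sepX).
Qed.
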